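(* Let $m,n$ be positive integers, $\mathcal{X}=\{x\in\mathbb{N}^n\colon\sum_{i=1}^n x_i=m\}$ (with $0\in\mathbb{N}$), let $p=(p_1,\dots,p_n)$ be a probability vector and let $\lambda_i\colon\{0,1,\dots,m\}\to[0,\infty)$, $i=1,\dots,n$, satisfy $\lambda_i(0)=0$ and $$\delta\le\lambda_i(l+1)-\lambda_i(l)\le\Delta\qquad\text{for } l\in\{0,1,\dots,m-1\},\ i=1,\dots,n,$$ where $\delta,\Delta$ are positive constants. Consider the zero-range dynamics with generator $$Lf(x)=\sum_{i,j=1}^n(f(x+e_j-e_i)-f(x))\lambda_i(x_i)p_j,$$ which is reversible with respect to the probability measure $\mu$ on $\mathcal{X}$ given by $$\mu(\{x\})=\frac1Z\prod_{i=1}^n\frac{p_i^{x_i}}{\lambda_i(1)\cdots\lambda_i(x_i)}.$$ Then for any $q\in(1,2]$ the Beckner inequality $$\alpha_q\bigl(\mu(f^q)-\mu(f)^q\bigr)\le\frac q2\,\mathcal{E}(f,f^{q-1})\quad\text{for all } f\colon\mathcal{X}\to[0,\infty)$$ holds with constant $\alpha_q\ge\frac{\delta^2}{12\Delta}$. As a consequence, if $X=(X_1,\dots,X_n)$ is a random vector with law $\mu$, then for every function $f\colon\mathcal{X}\to\mathbb{R}$ and $r\ge2$, $$\|(f(X)-\mathbb{E}f(X))_+\|_r\le K\frac{\sqrt\Delta}{\delta}\sqrt r\,\Bigl\|\Bigl(\sum_{i=1}^n\sum_{j=1}^n(f(X+e_j-e_i)-f(X))_-^2\,\lambda_i(X_i)p_j\Bigr)^{1/2}\Bigr\|_r,$$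 where $K=\sqrt{\frac{6\sqrt e}{\sqrt e-1}}$.
   Context: $e_1,\dots,e_n$ is the standard basis of $\mathbb{R}^n$; terms with $x_i=0$ vanish since $\lambda_i(0)=0$. $\mathcal{E}(f,g)=-\mu(f\,Lg)=\frac12\sum_{x\in\mathcal{X}}\mu(\{x\})\sum_{i,j}(f(x+e_j-e_i)-f(x))(g(x+e_j-e_i)-g(x))\lambda_i(x_i)p_j$ is the associated Dirichlet form; $Z$ is the normalizing constant. $\mu(f)=\int f\,d\mu$; $\|Y\|_r=(\mathbb{E}|Y|^r)^{1/r}$; $t_+=\max(t,0)$, $t_-=\max(-t,0)$. *)

(* Defs.v *)
From HB Require Import structures.
From mathcomp Require Import all_boot all_order all_algebra.
From mathcomp Require Import all_classical all_reals all_analysis.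
From mathcomp Require Import zify.
Set Implicit Arguments.
Unset Strict Implicit.
Unset Printing Implicit Defensive.
Import Order.TTheory GRing.Theory Num.Theory.
Import numFieldNormedType.Exports.

Local Open Scope ring_scope.

(* {x in N^n : x_1 + ... + x_n = m}; every coordinate of such an x is at most
   m, so the configurations form a finite type. *)
Record config (n m : nat) := Config {
  config_val : {ffun 'I_n -> 'I_m.+1};
  _ : (\sum_i (config_val i : nat) == m)%N }.
HB.instance Definition _ (n m : nat) := [isSub for @config_val n m].
HB.instance Definition _ (n m : nat) := [Countable of config n m by <:].
HB.instance Definition _ (n m : nat) := [Finite of config n m by <:].

Definition occ n m (x : config n m) (i : 'I_n) : nat := val x i.

(* x + e_j - e_i. When x_i = 0 and i != j this point is outside the state space
   and [move x i j] takes the junk value x; wherever [move] is used the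
   corresponding term carries the factor lambda_i(0) = 0. *)
Definition move n m (x : config n m) (i j : 'I_n) : config n m :=
  insubd x [ffun k => inord (occ x k + (k == j) - (k == i))%N].

Lemma occ_sum n m (x : config n m) : (\sum_i occ x i)%N = m.
Proof. by apply/eqP; exact: (valP x). Qed.

Lemma occ_move n m (x : config n m) (i j : 'I_n) : (0 < occ x i)%N ->
  forall k, occ (move x i j) k = (occ x k + (k == j) - (k == i))%N.
Proof.
move=> xi0.
have sumE : (\sum_k (occ x k + (k == j) - (k == i)) = m)%N.
  have : (\sum_k (occ x k + (k == j) - (k == i)) + \sum_(k < n) (k == i)
      = \sum_k occ x k + \sum_(k < n) (k == j))%N.
    rewrite -!big_split /=; apply: eq_bigr => k _.
    rewrite subnK//; case: (k =P i) => [->|//]; lia.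
  have one (l : 'I_n) : (\sum_(k < n) (k == l) = 1)%N.
    by rewrite (bigD1 l)//= eqxx big1// => k /negbTE ->.
  rewrite !one occ_sum; lia.
have bnd k : (occ x k + (k == j) - (k == i) < m.+1)%N.
  by rewrite ltnS -[leqRHS]sumE (bigD1 k)//= leq_addr.
move=> k; rewrite {1}/occ /move val_insubd ifT; first by rewrite ffunE inordK.
by apply/eqP; rewrite -[RHS]sumE; apply: eq_bigr => l _; rewrite ffunE inordK.
Qed.

Section ZeroRange.
Variables (R : realType) (n m : nat).
(* Only the values lambda i l with l <= m are ever used. *)
Variables (p : 'I_n -> R) (lambda : 'I_n -> nat -> R).
Implicit Types (f g : config n m -> R) (x : config n m).

Definition zr_weight x : R :=
  \prod_(i < n) (p i ^+ occ x i / \prod_(1 <= l < (occ x i).+1) lambda i l).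

Definition zr_Z : R := \sum_(x : config n m) zr_weight x.

Definition zr_mu x : R := zr_Z^-1 * zr_weight x.

Definition zr_mean f : R := \sum_(x : config n m) zr_mu x * f x.

Definition zr_gen f x : R :=
  \sum_(i < n) \sum_(j < n) (f (move x i j) - f x) * lambda i (occ x i) * p j.

Definition zr_dirichlet f g : R := - zr_mean (fun x => f x * zr_gen g x).

Definition zr_reversible : Prop :=
  forall f g, zr_mean (fun x => f x * zr_gen g x)
            = zr_mean (fun x => zr_gen f x * g x).

End ZeroRange.

(* X : T -> S is a random element of the finite (discrete) space S whose law
   under P has point masses w. *)
Definition has_law d (T : measurableType d) (R : realType) (P : probability T R)
    (S : finType) (X : T -> S) (w : S -> R) : Prop :=
  forall x : S, measurable (X @^-1` [set x])%classic /\
                P (X @^-1` [set x])%classic = (w x)%:E.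

(* Main.v *)
(* The Beckner inequality follows Hermon and Salez.  Write Phi(t) = t^q
   and D(a, b) = (a - b) (Phi'(a) - Phi'(b)).  For 1 < q <= 2 the function D is
   jointly convex, because the Bregman divergence of t^q is.  One shows by
   induction on the set S of sites on which the dynamics is allowed to act that
     p(S) * Ent_S(f) <= (Delta / delta^2) * sum over i <> j in S of E[lambda_i p_j D],
   where Ent_S is the average conditional Phi-entropy given the sites outside S.
   For the induction step one removes a site i of S, the choice of i being averaged
   with weights p(S \ i), and splits Ent_S into Ent_(S \ i) and the Phi-entropy of
   a function of X_i alone.  X_i evolves as a birth and death chain whose rates have
   increments adding up to at least delta p(S), so its Phi-entropy is controlled
   by the discrete Bakry-Emery argument.  The gradient of the conditional
   expectation given X_i is rewritten by coupling the systems with k and k + 1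
   particles through a stationary second-class particle; the law of its position
   given the environment is at most (Delta / delta) p_j / p(S \ i), and convexity
   of D concludes.

   The moment bound follows from the argument of Boucheron, Bousquet, Lugosi and
   Massart: Beckner's inequality for (f - E f)_+^(r-1) with q = r / (r - 1) bounds
   the r-th moment of (f - E f)_+ by its (r-1)-th moment, and one iterates. *)
Require Import Defs.
From HB Require Import structures.
From mathcomp Require Import all_boot all_order all_algebra.
From mathcomp Require Import all_classical all_reals all_analysis.
From mathcomp Require Import measurable_realfun ring lra zify.
Set Implicit Arguments.
Unset Strict Implicit.
Unset Printing Implicit Defensive.
Import Order.TTheory GRing.Theory Num.Theory.
Import numFieldNormedType.Exports.

Local Open Scope ring_scope.

(** * Powers and Bregman divergences *)

(** Convexity enters only through supporting lines and planes. In this form it can be summed against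
    any finite family of weights, so Jensen's inequality is immediate, both for [Phi] along one step
    of a kernel and for D under a coupling. Joint convexity is what is needed there, since a
    coupling averages the two arguments of D simultaneously. The coordinate X_i is in general not
    Markov by itself. Its jump rates, averaged over the configurations with a given value of X_i,
    still define a reversible chain; the second-class particle serves a second time to show that the
    averaged birth rate decreases with X_i. Functions stay positive up to the end, because powers
    with exponents below 1 are differentiated; zero values come back by a limit. Constants: the
    induction yields Beckner's inequality with delta^2 / (4 Delta), so 12 leaves a factor 3 of room.
    K comes from 12 / 2 = 6 and 1 / (1 - e^(-1/2)) = sqrt e / (sqrt e - 1). *)

Definition sym_bregman (R : realType) (dPhi : R -> R) (x y : R) :=
  (x - y) * (dPhi x - dPhi y).

Section Powers.
Variable R : realType.
Implicit Types a b c d s t x y : R.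

(** Young's inequality with conjugate exponents 1/(1-t) and 1/t; one of them degenerates at each
    endpoint, hence the separate cases. *)
Lemma weighted_AMGM x y t : 0 <= x -> 0 <= y -> 0 <= t <= 1 ->
  x `^ (1 - t) * y `^ t <= (1 - t) * x + t * y.
Proof.
move=> x0 y0 /andP[t0 t1].
have [->|tn0] := eqVneq t 0.
  by rewrite subr0 powRr1// powRr0 mul0r addr0 mulr1 ?subr0 !mul1r.
have [->|tn1] := eqVneq t 1.
  by rewrite subrr powRr1// powRr0 mul0r add0r !mul1r.
have tp : 0 < t by rewrite lt_def tn0.
have tp' : 0 < 1 - t by rewrite subr_gt0 lt_def eq_sym tn1.
have := @conjugate_powR R (x `^ (1 - t)) (y `^ t) (1 - t)^-1 t^-1
  (powR_ge0 _ _) (powR_ge0 _ _).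
rewrite !invr_gt0 !invrK subrK -!powRrM !mulfV ?gt_eqF// !powRr1//.
by move=> /(_ tp' tp erefl); rewrite (mulrC x) (mulrC y).
Qed.

(** Weighted AM-GM for x^t and y^t with weight 1/t. Unlike an argument by derivatives, this covers y
    = 0, which occurs for positive parts. *)
Lemma powR_tangent t x y : 1 <= t -> 0 < x -> 0 <= y ->
  x `^ t + t * x `^ (t - 1) * (y - x) <= y `^ t.
Proof.
move=> t1 x0 y0.
have t0 : 0 < t by exact: lt_le_trans t1.
have := @weighted_AMGM (x `^ t) (y `^ t) t^-1 (powR_ge0 _ _) (powR_ge0 _ _).
rewrite invr_ge0 ltW//= invf_le1// => /(_ t1).
rewrite -!powRrM mulfV ?gt_eqF// powRr1// mulrBr mulr1 mulfV ?gt_eqF//.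
have xE : x `^ t = x * x `^ (t - 1) by rewrite mulr_powRB1// ltW.
rewrite xE -(ler_pM2l t0).
have -> : t * ((1 - t^-1) * (x * x `^ (t - 1)) + t^-1 * y `^ t)
  = (t - 1) * x * x `^ (t - 1) + y `^ t by field; rewrite gt_eqF.
lra.
Qed.

Lemma second_order_tangent (g g1 g2 : R -> R) :
  (forall t, 0 <= t <= 1 -> is_derive t 1 g (g1 t)) ->
  (forall t, 0 <= t <= 1 -> is_derive t 1 g1 (g2 t)) ->
  (forall t, 0 <= t <= 1 -> 0 <= g2 t) ->
  g 0 + g1 0 <= g 1.
Proof.
move=> dg dg1 g2_ge0.
have cont (f df : R -> R) (l : R) : l <= 1 ->
    (forall t, 0 <= t <= 1 -> is_derive t 1 f (df t)) ->
    {within `[0, l], continuous f}%classic.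
  move=> l1 H; apply: derivable_within_continuous => t.
  rewrite in_itv/= => /andP[t0 tl].
  by have := H t; rewrite t0 (le_trans tl l1) => /(_ erefl) [].
have [c cI gE] : exists2 c, c \in `]0, 1[%R & g 1 - g 0 = g1 c * (1 - 0).
  apply: MVT => //; last exact: cont dg.
  by move=> t; rewrite in_itv/= => /andP[t0 t1]; apply: dg; rewrite !ltW.
move: cI; rewrite in_itv/= => /andP[c0 c1].
have [e eI g1E] : exists2 e, e \in `]0, c[%R & g1 c - g1 0 = g2 e * (c - 0).
  apply: MVT => //; last exact: cont (ltW c1) dg1.
  move=> t; rewrite in_itv/= => /andP[t0 t1]; apply: dg1.
  by rewrite (ltW t0) (le_trans (ltW t1) (ltW c1)).
move: eI; rewrite in_itv/= => /andP[e0 ec].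
have : 0 <= g2 e * (c - 0).
  by rewrite mulr_ge0 ?g2_ge0 ?subr0 ?(ltW e0) ?(ltW c0)//= (le_trans (ltW ec) (ltW c1)).
lra.
Qed.

Lemma is_derive_powR_line c u a t : 0 < c + t * u ->
  is_derive t 1 (fun t : R => (c + t * u) `^ a) (a * (c + t * u) `^ (a - 1) * u).
Proof.
move=> H.
have Hl : is_derive t (1 : R) (fun t : R => c + t * u) u.
  by apply: is_derive_eq; rewrite add0r mul1r scaler0 add0r; exact: mulr1.
have Hp := is_derive1_powR a H.
exact: (@is_derive1_comp R (fun x => x `^ a) (fun t : R => c + t * u) t _ _ Hp Hl).
Qed.

(** The left side is the tangent plane at (c, d) of the Bregman divergence of t^(1+s). Along the
    segment from (c, d) to (a, b) convexity becomes a one-variable statement: [g1] and [g2] are the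
    first two derivatives, and [g2] is a quadratic form in the direction (u, v). *)
Lemma bregman_powR_tangent s a b c d :
  0 < s <= 1 -> 0 < a -> 0 < b -> 0 < c -> 0 < d ->
  (c `^ (1 + s) + s * d `^ (1 + s) - (1 + s) * c * d `^ s)
  + (1 + s) * (c `^ s - d `^ s) * (a - c)
  - (1 + s) * s * d `^ (s - 1) * (c - d) * (b - d)
  <= a `^ (1 + s) + s * b `^ (1 + s) - (1 + s) * a * b `^ s.
Proof.
move=> /andP[s0 s1] a0 b0 c0 d0.
pose u := a - c; pose v := b - d.
pose x t := c + t * u; pose y t := d + t * v.
have xp t : 0 <= t <= 1 -> 0 < x t.
  by rewrite /x /u => /andP[t0 t1]; nra.
have yp t : 0 <= t <= 1 -> 0 < y t.
  by rewrite /y /v => /andP[t0 t1]; nra.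
pose g t := x t `^ (1 + s) + s * y t `^ (1 + s) - (1 + s) * x t * y t `^ s.
pose g1 t := (1 + s) * (x t `^ s - y t `^ s) * u
   - (1 + s) * s * y t `^ (s - 1) * (x t - y t) * v.
pose g2 t := (1 + s) * s * (x t `^ (s - 1) * u ^+ 2
   - 2 * y t `^ (s - 1) * u * v
   + (y t `^ (s - 1) - (s - 1) * y t `^ (s - 1 - 1) * (x t - y t)) * v ^+ 2).
have x_0 : x 0 = c by rewrite /x mul0r addr0.
have x_1 : x 1 = a by rewrite /x mul1r /u addrC subrK.
have y_0 : y 0 = d by rewrite /y mul0r addr0.
have y_1 : y 1 = b by rewrite /y mul1r /v addrC subrK.
suff : g 0 + g1 0 <= g 1 by rewrite /g /g1 x_0 x_1 y_0 y_1 addrA.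
apply: (@second_order_tangent g g1 g2).
- move=> t /[dup] /xp xt /yp yt.
  have d1 := @is_derive_powR_line c u (1 + s) t xt.
  have d2 := @is_derive_powR_line d v (1 + s) t yt.
  have d3 := @is_derive_powR_line d v s t yt.
  rewrite /g /x /y; apply: is_derive_eq.
  rewrite /GRing.scale/= /g1 -/(x t) -/(y t) (addrC 1 s) addrK.
  have -> : y t `^ s = y t * y t `^ (s - 1) by rewrite mulr_powRB1// ltW.
  by rewrite /x /y; ring.
- move=> t /[dup] /xp xt /yp yt.
  have d1 := @is_derive_powR_line c u s t xt.
  have d2 := @is_derive_powR_line d v s t yt.
  have d3 := @is_derive_powR_line d v (s - 1) t yt.
  rewrite /g1 /x /y; apply: is_derive_eq.
  by rewrite /GRing.scale/= /g2 /x /y; ring.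
- move=> t /[dup] /xp xt /yp yt.
  rewrite /g2.
  have xE : x t `^ s = x t * x t `^ (s - 1) by rewrite mulr_powRB1// ltW.
  have yE : y t `^ (s - 1) = y t * y t `^ (s - 1 - 1).
    rewrite -{2}(powRr1 (ltW yt)) -powRD ?(gt_eqF yt) ?implybT//.
    by congr (_ `^ _); ring.
  have := @weighted_AMGM (x t) (y t) s (ltW xt) (ltW yt).
  rewrite (ltW s0) s1 => /(_ erefl).
  have -> : x t `^ (1 - s) = (x t `^ (s - 1))^-1 by rewrite -powRN opprB.
  have -> : y t `^ s = y t * y t `^ (s - 1) by rewrite mulr_powRB1// ltW.
  rewrite !yE.
  have := powR_gt0 (s - 1) xt; have := powR_gt0 (s - 1 - 1) yt.
  move: (x t) (y t) xt yt (x t `^ (s - 1)) (y t `^ (s - 1 - 1)) => X Y X0 Y0 A Q Q0 A0.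
  (* AM-GM says that the discriminant of the quadratic form in (u, v) is at most 0. *)
  rewrite mulrC -ler_pdivlMr ?invr_gt0// invrK => H.
  have -> : A * u ^+ 2 - 2 * (Y * Q) * u * v + (Y * Q - (s - 1) * Q * (X - Y)) * v ^+ 2
     = (A * u - Y * Q * v) ^+ 2 / A + Q * (((1 - s) * X + s * Y) - Y ^+ 2 * Q / A) * v ^+ 2.
    by field; rewrite gt_eqF.
  apply: mulr_ge0; first by rewrite mulr_ge0 ?addr_ge0 ?ltW.
  apply: addr_ge0.
    by rewrite mulr_ge0 ?sqr_ge0// invr_ge0 ltW.
  rewrite mulr_ge0 ?sqr_ge0// mulr_ge0 ?(ltW Q0)// subr_ge0.
  rewrite ler_pdivrMr//; by apply: le_trans H; rewrite expr2 mulrA.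
Qed.

(** (1 + s) D(a, b) is the sum of the Bregman divergences of (a, b) and of (b, a), so the two
    tangent planes add up. *)
Lemma sym_bregman_powR_tangent s c d : 0 < s <= 1 -> 0 < c -> 0 < d ->
  exists e1 e2, forall a b, 0 < a -> 0 < b ->
    (c - d) * (c `^ s - d `^ s) + e1 * (a - c) + e2 * (b - d)
    <= (a - b) * (a `^ s - b `^ s).
Proof.
move=> s01 c0 d0; have s0 : 0 < s by case/andP: s01.
(* The witnesses are the two partial derivatives of D at (c, d). *)
exists ((c `^ s - d `^ s) - s * c `^ (s - 1) * (d - c)).
exists ((d `^ s - c `^ s) - s * d `^ (s - 1) * (c - d)) => a b a0 b0.
have q0 : 0 < 1 + s by rewrite addr_gt0.
rewrite -(ler_pM2l q0).
have H1 := bregman_powR_tangent s01 a0 b0 c0 d0.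
have H2 := bregman_powR_tangent s01 b0 a0 d0 c0.
have powS x : 0 < x -> x `^ (1 + s) = x * x `^ s.
  by move=> x0; rewrite powRD ?powRr1 ?(gt_eqF x0) ?implybT// ltW.
move: H1 H2; rewrite !powS// => H1 H2.
lra.
Qed.

End Powers.

(** * Stationary measures of finite Markov chains *)

Section Stationary.
Variables (R : realType) (O E : finType).

(** The generator matrix [M] has zero row sums, so it is singular and has a nonzero left null vector
    v; normalising |v| gives the measure. *)
Lemma stationary_measure (Q : O -> O -> R) (w0 : O) :
  (forall x y, 0 <= Q x y) ->
  exists pi : O -> R, [/\ forall x, 0 <= pi x, \sum_x pi x = 1 &
    forall phi : O -> R, \sum_x pi x * (\sum_y Q x y * (phi y - phi x)) = 0].
Proof.
move=> Q0.
pose N := #|{: O}|; pose e : 'I_N -> O := enum_val.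
pose M : 'M[R]_N := \matrix_(i, j) (Q (e i) (e j) - (i == j)%:R * \sum_k Q (e i) (e k)).
have : \det M == 0.
  rewrite -det_tr; apply/det0P; exists (const_mx 1).
    apply/eqP => /matrixP /(_ 0 (enum_rank w0)); rewrite !mxE.
    by apply/eqP; rewrite oner_eq0.
  apply/matrixP => i j; rewrite !mxE.
  under eq_bigr do rewrite !mxE mul1r.
  rewrite sumrB (bigD1 j)//= [X in _ - X](bigD1 j)//= eqxx mul1r.
  rewrite [X in _ - (_ + X)]big1 ?addr0 -?(bigD1 j) ?subrr// => k kj.
  by rewrite eq_sym (negbTE kj) mul0r.
case/det0P => v v0 vM.
pose f x := `|v 0 (enum_rank x)|.
have eK x : e (enum_rank x) = x by rewrite /e enum_rankK.
have sumE (F : O -> R) : \sum_k F (e k) = \sum_x F x.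
  by rewrite [RHS](reindex e)//; exact: (onW_bij _ (enum_val_bij _)).
have f0 x : 0 <= f x by exact: normr_ge0.
have fle y : f y * (\sum_x Q y x) <= \sum_x f x * Q x y.
  move/matrixP : vM => /(_ 0 (enum_rank y)); rewrite !mxE.
  under eq_bigr do rewrite !mxE mulrBr.
  rewrite sumrB => /subr0_eq; rewrite [X in _ = X](bigD1 (enum_rank y))//= eqxx mul1r.
  rewrite [X in _ = _ + X]big1 ?addr0; last by move=> k /negbTE ->; rewrite mul0r mulr0.
  rewrite !eK sumE => vE.
  rewrite -[X in _ * X]ger0_norm ?sumr_ge0// /f -normrM -vE.
  apply: le_trans (ler_norm_sum _ _ _) _.
  rewrite -sumE; apply: ler_sum => k _.
  by rewrite normrM (ger0_norm (Q0 _ _)) /e enum_valK.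
(* The triangle inequality only makes |v| subinvariant. Outflow and inflow have the same total over
   all states, so every inequality is an equality. *)
have feq y : f y * (\sum_x Q y x) = \sum_x f x * Q x y.
  apply/eqP; rewrite eq_sym -subr_eq0.
  have /psumr_eq0P H : \sum_y ((\sum_x f x * Q x y) - f y * (\sum_x Q y x)) = 0.
    rewrite sumrB exchange_big/=; apply/eqP; rewrite subr_eq0; apply/eqP.
    by apply: eq_bigr => x _; rewrite mulr_sumr.
  by rewrite H// => z _; rewrite subr_ge0.
have F0 : 0 < \sum_x f x.
  rewrite lt_def sumr_ge0// andbT; apply: contra v0 => /eqP/psumr_eq0P H.
  apply/eqP/matrixP => i j; rewrite ord1 mxE; apply/eqP.
  have := H (fun x _ => f0 x) (e j) isT.
  by rewrite /f /e enum_valK => /eqP; rewrite normr_eq0.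
exists (fun x => (\sum_x f x)^-1 * f x); split => [x||phi].
- by rewrite mulr_ge0// invr_ge0 ltW.
- by rewrite -mulr_sumr mulVf// gt_eqF.
- under eq_bigr do rewrite -mulrA.
  rewrite -mulr_sumr; apply/eqP; rewrite mulf_eq0; apply/orP; right; apply/eqP.
  under eq_bigr do rewrite mulr_sumr.
  rewrite (eq_bigr (fun x => \sum_y f x * Q x y * phi y
    - f x * (\sum_y Q x y) * phi x)); last first.
    move=> x _; rewrite mulr_sumr mulr_suml -sumrB; apply: eq_bigr => y _; ring.
  rewrite sumrB exchange_big/= -sumrB big1// => y _.
  by rewrite feq mulr_suml subrr.
Qed.

End Stationary.

(** Events, and not target states, index the transitions: distinct jumps with the same target need
    not be merged, and the generator keeps the form in which it is used. *)
Lemma stationary_measure_closed (R : realType) (O E : finType) (A : pred O)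
    (w0 : O) (c : O -> E -> R) (tau : O -> E -> O) :
  A w0 -> (forall x e, 0 <= c x e) ->
  (forall x e, A x -> c x e != 0 -> A (tau x e)) ->
  exists pi : O -> R,
    [/\ forall x, 0 <= pi x, forall x, ~~ A x -> pi x = 0, \sum_x pi x = 1 &
    forall phi : O -> R,
      \sum_x pi x * (\sum_e c x e * (phi (tau x e) - phi x)) = 0].
Proof.
move=> Aw0 c0 cA.
(* Outside of A the chain is sent to w0, so that A carries all the mass. *)
pose Q x y : R := if A x then \sum_(e | tau x e == y) c x e else (y == w0)%:R.
have QE x (phi : O -> R) : A x -> \sum_y Q x y * (phi y - phi x)
    = \sum_e c x e * (phi (tau x e) - phi x).
  move=> Ax; rewrite (partition_big (tau x) predT)//=; apply: eq_bigr => y _.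
  by rewrite /Q Ax mulr_suml; apply: eq_bigr => e /eqP ->.
have [|pi [pi0 pi1 piQ]] := @stationary_measure R O Q w0.
  by move=> x y; rewrite /Q; case: ifP => _; [exact: sumr_ge0|exact: ler0n].
(* Test stationarity with the indicator of A: from A it never changes, and outside of A it is gained
   at rate 1, so no mass lies outside. *)
have piA x : ~~ A x -> pi x = 0.
  have := piQ (fun x => (A x)%:R).
  rewrite (eq_bigr (fun x => if A x then 0 else pi x)); last first.
    move=> z _; case: (boolP (A z)) => Az.
      have /= := QE z (fun x => (A x)%:R) Az; rewrite Az => ->.
      rewrite big1 ?mulr0// => e _; have [->|/cA->] := eqVneq (c z e) 0.
      - by rewrite mul0r.
      - by rewrite subrr mulr0.
      - by [].
    rewrite (bigD1 w0)//= big1 ?addr0; last first.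
      by move=> y yw; rewrite /Q (negbTE Az) (negbTE yw) mul0r.
    by rewrite /Q (negbTE Az) eqxx Aw0 subr0 !mulr1.
  move=> /psumr_eq0P H Ax; rewrite -(H _ x)//; first by rewrite (negbTE Ax).
  by move=> z _; case: ifP.
exists pi; split => // phi; rewrite -[RHS](piQ phi); apply: eq_bigr => x _.
by case: (boolP (A x)) => Ax; [rewrite QE | rewrite piA// !mul0r].
Qed.

(** * Configurations *)

Section Configurations.
Variables n m : nat.
Implicit Types (x y z : config n m) (S T : {set 'I_n}) (i j a b k : 'I_n).

Lemma config_ext x y : (forall k, occ x k = occ y k) -> x = y.
Proof. by move=> H; apply/val_inj/ffunP => k; apply/val_inj; exact: H. Qed.

Lemma occ_le x i : (occ x i <= m)%N.
Proof. by rewrite -ltnS ltn_ord. Qed.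

Lemma occ_lt x i j : i != j -> (0 < occ x i)%N -> (occ x j < m)%N.
Proof.
move=> ij xi; rewrite -{2}(occ_sum x) (bigD1 i)//= (bigD1 j) 1?eq_sym//=; lia.
Qed.

Lemma moveK x i j : (0 < occ x i)%N -> move (move x i j) j i = x.
Proof.
move=> xi; have E := occ_move (i := i) j xi.
apply: config_ext => k; rewrite occ_move !E ?eqxx; last first.
  by case: (eqVneq j i) => [->|_]; lia.
by case: (eqVneq k i) => [->|]; case: (eqVneq _ j) => [?|]; lia.
Qed.

Lemma move_swap x i j a b : i != a -> (0 < occ x i)%N -> (0 < occ x a)%N ->
  move (move x i j) a b = move (move x a b) i j.
Proof.
move=> ia xi xa; have Ei := occ_move (i := i) j xi; have Ea := occ_move (i := a) b xa.
have iaF := negbTE ia; have aiF : (a == i) = false by rewrite eq_sym.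
apply: config_ext => k; rewrite !occ_move ?Ei ?Ea.
  case: (eqVneq k i) => [->|]; case: (eqVneq _ a) => [?|]; subst;
    by rewrite ?eqxx in ia *; lia.
all: by rewrite ?iaF ?aiF; lia.
Qed.

Lemma move_move x i j b : (0 < occ x i)%N -> move (move x i j) j b = move x i b.
Proof.
move=> xi; have E := occ_move (i := i) j xi.
apply: config_ext => k; rewrite !occ_move// ?E ?eqxx; last first.
  by case: (eqVneq j i) => [->|_]; lia.
by case: (eqVneq k i) => [->|]; case: (eqVneq _ j) => [?|]; lia.
Qed.

(** As the total is m, agreeing configurations also have equally many particles in S: a class is the
    state space of the dynamics on S. *)
Definition agree S x y := [forall k, (k \in S) || (occ x k == occ y k)].

Lemma agreeP S x y :
  reflect (forall k, k \notin S -> occ x k = occ y k) (agree S x y).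
Proof.
apply: (iffP forallP) => H k; last first.
  by case: (boolP (k \in S)) => //= /H ->.
by move=> /negbTE kS; have := H k; rewrite kS => /eqP.
Qed.

Lemma agree_refl S x : agree S x x. Proof. exact/agreeP. Qed.

Lemma agree_sym S x y : agree S x y = agree S y x.
Proof. by apply/agreeP/agreeP => H k /H. Qed.

Lemma agree_trans S x y z : agree S x y -> agree S y z -> agree S x z.
Proof. by move=> /agreeP H /agreeP H'; apply/agreeP => k kS; rewrite H ?H'. Qed.

Lemma agree_eqr S x y z : agree S y z -> agree S x y = agree S x z.
Proof.
move=> yz; apply/idP/idP => H; first exact: agree_trans yz.
by apply: agree_trans H _; rewrite agree_sym.
Qed.

Lemma agree_eql S x y z : agree S x y -> agree S x z = agree S y z.
Proof. by move=> xy; rewrite -!(agree_sym _ z); exact: agree_eqr. Qed.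

Lemma agree_sub S T x y : T \subset S -> agree T x y -> agree S x y.
Proof.
move=> /fintype.subsetP TS /agreeP H; apply/agreeP => k kS; apply: H.
by apply: contra kS => /TS.
Qed.

Lemma agree_move S x i j : i \in S -> j \in S -> (0 < occ x i)%N ->
  agree S x (move x i j).
Proof.
move=> iS jS xi; apply/agreeP => k kS; rewrite occ_move//.
have -> : (k == i) = false by apply: contraNF kS => /eqP ->.
have -> : (k == j) = false by apply: contraNF kS => /eqP ->.
by rewrite addn0 subn0.
Qed.

Lemma agree_move2 T x y i j l : j \in T -> l \in T ->
  (0 < occ x i)%N -> (0 < occ y i)%N ->
  agree T x y -> agree T (move x i j) (move y i l).
Proof.
move=> jT lT xi yi /agreeP H; apply/agreeP => k kT; rewrite !occ_move// (H _ kT).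
have -> : (k == j) = false by apply: contraNF kT => /eqP ->.
by have -> : (k == l) = false by apply: contraNF kT => /eqP ->.
Qed.

(** Irreducibility of the dynamics on T within a class: gather all particles of T at one site j0.
    The gathered configurations agree off j0, and the common total makes them equal at j0. *)
Lemma move_invariant_agree (V : Type) (u : config n m -> V) T :
  (forall x i j, i \in T -> j \in T -> (0 < occ x i)%N -> u (move x i j) = u x) ->
  forall x y, agree T x y -> u x = u y.
Proof.
move=> uM x y xy.
have [j0 j0T|T0] := pickP (mem T); last first.
  congr u; apply: config_ext => k; move/agreeP: xy; apply.
  by have := T0 k; rewrite /= => ->.
have gather N : forall x, (\sum_(k in T | k != j0) occ x k <= N)%N ->
    exists z, [/\ u x = u z, agree T x z &
      forall k, k \in T -> k != j0 -> occ z k = 0%N].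
  elim: N => [|N IH] z.
    rewrite leqn0 sum_nat_eq0 => /forallP H; exists z; split => //.
      exact: agree_refl.
    by move=> k kT kj; have := H k; rewrite kT kj => /eqP.
  have [i /and3P[iT ij zi]|H0] := pickP [pred i | [&& i \in T, i != j0 & (0 < occ z i)%N]].
    rewrite (bigD1 i) ?iT//= => H.
    have [|w [uw aw w0]] := IH (move z i j0).
      rewrite (bigD1 i) ?iT//= occ_move// eqxx (negbTE ij) addn0.
      rewrite (eq_bigr (occ z)); first lia.
      move=> k /andP[/andP[_ kj] ki].
      by rewrite occ_move// (negbTE ki) (negbTE kj) addn0 subn0.
    exists w; split => //; first by rewrite -uw uM.
    by apply: agree_trans aw; exact: agree_move.
  move=> _; exists z; split => //; first exact: agree_refl.
  by move=> k kT kj; have := H0 k; rewrite /= kT kj/=; lia.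
have [z [-> az z0]] := gather _ x (leqnn _).
have [w [-> aw w0]] := gather _ y (leqnn _).
congr u.
have zw k : k != j0 -> occ z k = occ w k.
  move=> kj; case: (boolP (k \in T)) => kT; first by rewrite z0 ?w0.
  by rewrite -(agreeP _ _ _ az) // (agreeP _ _ _ xy) // (agreeP _ _ _ aw).
apply: config_ext => k; have [->|/zw//] := eqVneq k j0.
have := etrans (occ_sum z) (esym (occ_sum w)).
rewrite (bigD1 j0)//= [X in _ = X](bigD1 j0)//=.
by rewrite (eq_bigr (occ w)) => [/addIn|k' /zw].
Qed.

End Configurations.

(** * Birth and death chains *)

Lemma le_geometric_perturbation (R : realType) (X Y C rho : R) :
  0 <= rho < 1 -> (forall n, X <= Y + C * rho ^+ n) -> X <= Y.
Proof.
move=> /andP[r0 r1] H.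
have H1 : ((fun n => Y + C * rho ^+ n) @ \oo --> Y + C * 0)%classic.
  apply: cvgD; first exact: cvg_cst.
  apply: cvgM; first exact: cvg_cst.
  by apply: cvg_expr; rewrite ger0_norm.
move: H1; rewrite mulr0 addr0 => H1.
by apply: (@cvgr_to_ge _ _ _ _ _ _ _ H1); apply: nearW.
Qed.

Section BirthDeath.
Variables (R : realType) (Phi dPhi : R -> R).
Hypothesis Phi_tangent : forall x y, 0 < x -> 0 < y ->
  Phi x + dPhi x * (y - x) <= Phi y.
Local Notation D := (sym_bregman dPhi).
Hypothesis D_tangent : forall c d, 0 < c -> 0 < d ->
  exists e1 e2, forall a b, 0 < a -> 0 < b ->
    D c d + e1 * (a - c) + e2 * (b - d) <= D a b.

Lemma dPhi_le x y : 0 < x -> x <= y -> dPhi x <= dPhi y.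
Proof.
move=> x0 xy; have y0 : 0 < y by exact: lt_le_trans xy.
move: xy; rewrite le_eqVlt => /predU1P[->//|xy].
have H1 := Phi_tangent x0 y0; have H2 := Phi_tangent y0 x0.
have {H1 H2} H : 0 <= (dPhi y - dPhi x) * (y - x) by lra.
by move: H; rewrite pmulr_lge0 ?subr_gt0// subr_ge0.
Qed.

Lemma sym_bregman_ge0 x y : 0 < x -> 0 < y -> 0 <= D x y.
Proof.
move=> x0 y0; rewrite /sym_bregman; case: (leP x y) => [xy|/ltW xy].
  by rewrite -mulrNN mulr_ge0// oppr_ge0 subr_le0// dPhi_le.
by rewrite mulr_ge0// subr_ge0// dPhi_le.
Qed.

Variables (M : nat) (pi a b : nat -> R) (gamma : R).
Hypothesis M_gt0 : (0 < M)%N.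
Hypothesis gamma_gt0 : 0 < gamma.
Hypothesis pi_gt0 : forall k, (k <= M)%N -> 0 < pi k.
Hypothesis a0 : a 0%N = 0.
Hypothesis bM : b M = 0.
Hypothesis pi_rev : forall k, (k < M)%N -> pi k.+1 * a k.+1 = pi k * b k.
Hypothesis a_incr : forall k, (k < M)%N -> a k <= a k.+1.
Hypothesis b_decr : forall k, (k < M)%N -> b k.+1 <= b k.
Hypothesis ab_incr : forall k, (k < M)%N ->
  gamma <= a k.+1 - a k + (b k - b k.+1).
Implicit Types F G : nat -> R.

Let a_ge0 k : (k <= M)%N -> 0 <= a k.
Proof.
by elim: k => [|k IH] kM; rewrite ?a0// (le_trans (IH (ltnW kM)))// a_incr.
Qed.

Let b_ge0 k : (k <= M)%N -> 0 <= b k.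
Proof.
move=> kM; rewrite -(subKn kM); elim: (M - k)%N (leq_subr k M) => [|l IH] lM.
  by rewrite subn0 bM.
apply: le_trans (IH (ltnW lM)) _.
have -> : (M - l = (M - l.+1).+1)%N by rewrite subnSK.
by apply: b_decr; rewrite ltn_subrL M_gt0.
Qed.

Let total := \sum_(k < M.+1) (a k + b k).
(* The factor 2 makes 1 + eps * generator a Markov kernel for the chain of edges
   (k, k + 1) too, whose total jump rate is a (k + 1) + b k. *)
Let eps := (1 + 2 * total)^-1.

Let le_total k : (k <= M)%N -> a k + b k <= total.
Proof.
move=> kM; rewrite /total (bigD1 (Ordinal (n := M.+1) (m := k) kM))//= lerDl.
by rewrite sumr_ge0// => i _; rewrite addr_ge0 ?a_ge0 ?b_ge0// -ltnS.
Qed.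

Let total_ge0 : 0 <= total.
Proof. by apply: le_trans (le_total (leq0n M)); rewrite addr_ge0 ?a_ge0 ?b_ge0. Qed.

Let eps_gt0 : 0 < eps.
Proof. by rewrite invr_gt0; have := total_ge0; lra. Qed.

Let eps_total : eps * (2 * total) < 1.
Proof.
rewrite /eps mulrC ltr_pdivrMr; have := total_ge0; lra.
Qed.

Let eps_edge k : (k < M)%N -> 0 <= 1 - eps * b k - eps * a k.+1.
Proof.
move=> kM; have := le_total kM; have := le_total (ltnW kM).
have := a_ge0 (ltnW kM); have := b_ge0 kM => b1 a1 H1 H2.
have := ler_wpM2l (ltW eps_gt0) (_ : a k.+1 + b k <= 2 * total).
by have := eps_total; lra.
Qed.

Let eps_site k : (k <= M)%N -> 0 < 1 - eps * b k - eps * a k.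
Proof.
move=> kM; have := le_total kM => H1.
have := ler_wpM2l (ltW eps_gt0) (_ : a k + b k <= 2 * total).
by have := eps_total; have := total_ge0; lra.
Qed.

(** One step of a discrete-time chain replaces the heat semigroup. The values of [F] beyond 0 and M
    are harmless, as they carry the rates [a 0] = [b M] = 0. *)
Let P F k := F k + eps * (b k * (F k.+1 - F k) + a k * (F k.-1 - F k)).

Let energy F := \sum_(k < M) pi k.+1 * a k.+1 * D (F k.+1) (F k).
Let entropy F := \sum_(k < M.+1) pi k * Phi (F k).

Let dirichlet F G :
  \sum_(k < M.+1) pi k * G k * (P F k - F k)
  = - eps * \sum_(k < M) pi k.+1 * a k.+1 * ((G k.+1 - G k) * (F k.+1 - F k)).
Proof.
transitivity (eps * (\sum_(k < M.+1) pi k * b k * (G k * (F k.+1 - F k)) +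
   \sum_(k < M.+1) pi k * a k * (G k * (F k.-1 - F k)))).
  rewrite -big_split mulr_sumr/=; apply: eq_bigr => k _; rewrite /P; ring.
rewrite big_ord_recr/= bM mulr0 mul0r addr0.
rewrite [X in _ + X]big_ord_recl/= a0 mulr0 mul0r add0r -big_split/= !mulr_sumr.
apply: eq_bigr => k _; rewrite -pi_rev// /bump leq0n add1n/=; ring.
Qed.

Let pos F := forall k, (k <= M)%N -> 0 < F k.

Let P_range F lo hi : (forall k, (k <= M)%N -> lo <= F k <= hi) ->
  forall k, (k <= M)%N -> lo <= P F k <= hi.
Proof.
move=> H k kM; have /andP[l0 h0] := H k kM.
have [b1 b2] : b k * lo <= b k * F k.+1 /\ b k * F k.+1 <= b k * hi.
  move: kM; rewrite leq_eqVlt => /predU1P[->|kM]; first by rewrite bM !mul0r.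
  have /andP[l1 h1] := H _ kM.
  by split; apply: ler_wpM2l => //; exact/b_ge0/ltnW.
have [a1 a2] : a k * lo <= a k * F k.-1 /\ a k * F k.-1 <= a k * hi.
  have /andP[l1 h1] := H k.-1 (leq_trans (leq_pred k) kM).
  by split; apply: ler_wpM2l => //; exact: a_ge0.
have PE c : P F k = c + (1 - eps * b k - eps * a k) * (F k - c)
   + eps * (b k * F k.+1 - b k * c) + eps * (a k * F k.-1 - a k * c).
  by rewrite /P; ring.
have s0 := ltW (eps_site kM); have e0 := ltW eps_gt0.
apply/andP; split.
  have := mulr_ge0 s0 (_ : 0 <= F k - lo).
  have := mulr_ge0 e0 (_ : 0 <= b k * F k.+1 - b k * lo).
  have := mulr_ge0 e0 (_ : 0 <= a k * F k.-1 - a k * lo).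
  by rewrite !subr_ge0 (PE lo) => /(_ a1) H1 /(_ b1) H2 /(_ l0) H3; lra.
have := mulr_ge0 s0 (_ : 0 <= hi - F k).
have := mulr_ge0 e0 (_ : 0 <= b k * hi - b k * F k.+1).
have := mulr_ge0 e0 (_ : 0 <= a k * hi - a k * F k.-1).
by rewrite !subr_ge0 (PE hi) => /(_ a2) H1 /(_ b2) H2 /(_ h0) H3; lra.
Qed.

Let lower F : pos F -> exists2 lo, 0 < lo & forall k, (k <= M)%N -> lo <= F k.
Proof.
rewrite /pos; elim: M => [|N IH] H.
  by exists (F 0%N); [exact: H|case].
have [k kN|lo lo0 loP] := IH; first by apply: H; exact: leqW.
exists (Num.min lo (F N.+1)); first by rewrite lt_min lo0 H.
move=> k; rewrite leq_eqVlt => /predU1P[->|/loP].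
  by rewrite ge_min lexx orbT.
by rewrite ge_min => ->.
Qed.

Let upper F : pos F -> exists hi, forall k, (k <= M)%N -> F k <= hi.
Proof.
move=> F0; exists (\sum_(k < M.+1) F k) => k kM.
rewrite (bigD1 (Ordinal (n := M.+1) (m := k) kM))//= lerDl sumr_ge0// => i _.
by rewrite ltW// F0// -ltnS.
Qed.

Let P_pos F : pos F -> pos (P F).
Proof.
move=> F0; have [lo lo0 loP] := lower F0; have [hi hiP] := upper F0 => k kM.
have H l (lM : (l <= M)%N) : lo <= F l <= hi by rewrite loP ?hiP.
by have /andP[+ _] := P_range H kM; exact: lt_le_trans.
Qed.

(** The tangent of [Phi] at F k bounds the loss from above by a Dirichlet form, without a
    second-order error in eps. *)
Let entropy_step F : pos F -> entropy F - entropy (P F) <= eps * energy F.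
Proof.
move=> F0.
have -> : eps * energy F = - \sum_(k < M.+1) pi k * dPhi (F k) * (P F k - F k).
  rewrite (dirichlet F (dPhi \o F)) mulNr opprK; congr (_ * _).
  by apply: eq_bigr => k _; rewrite /sym_bregman/=; ring.
rewrite -sumrB -sumrN; apply: ler_sum => k _.
have kM : (k <= M)%N by rewrite -ltnS.
have := ler_wpM2l (ltW (pi_gt0 kM)) (Phi_tangent (F0 _ kM) (P_pos F0 kM)).
lra.
Qed.

Let P_edge F k : (k < M)%N -> P F k.+1 - P F k
  = eps * b k.+1 * (F k.+2 - F k.+1) + eps * a k * (F k - F k.-1)
    + (1 - eps * b k - eps * a k.+1) * (F k.+1 - F k).
Proof. by move=> kM; rewrite /P/=; ring. Qed.

(** Jensen's inequality under the coupling of the chains started at k + 1 and k: the pair moves up,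
    moves down, stays, or coalesces at k or at k + 1. The coalescence weights are nonnegative by
    monotonicity of the rates, and D vanishes on the diagonal. *)
Let D_step F k : pos F -> (k < M)%N ->
  D (P F k.+1) (P F k)
  <= eps * b k.+1 * D (F k.+2) (F k.+1) + eps * a k * D (F k) (F k.-1)
     + (1 - eps * b k - eps * a k.+1) * D (F k.+1) (F k).
Proof.
move=> F0 kM.
have e0 := ltW eps_gt0.
have [e1 [e2 H]] := D_tangent (P_pos F0 kM) (P_pos F0 (ltnW kM)).
set c := P F k.+1; set d := P F k; rewrite -/c -/d in H.
have H1 : eps * b k.+1 * (D c d + e1 * (F k.+2 - c) + e2 * (F k.+1 - d))
    <= eps * b k.+1 * D (F k.+2) (F k.+1).
  move: (kM); rewrite leq_eqVlt => /predU1P[->|kM2].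
    by rewrite bM mulr0 !mul0r.
  by apply: ler_wpM2l; [rewrite mulr_ge0 ?b_ge0|exact: H (F0 _ kM2) (F0 _ kM)].
have H2 : eps * a k * (D c d + e1 * (F k - c) + e2 * (F k.-1 - d))
    <= eps * a k * D (F k) (F k.-1).
  apply: ler_wpM2l; first by rewrite mulr_ge0 ?a_ge0 ?(ltnW kM).
  by apply: H; apply: F0; lia.
have H3 := ler_wpM2l (eps_edge kM) (H _ _ (F0 _ kM) (F0 _ (ltnW kM))).
have diag x : D x x = 0 by rewrite /sym_bregman subrr mul0r.
have H4 : eps * (a k.+1 - a k) * (D c d + e1 * (F k - c) + e2 * (F k - d)) <= 0.
  rewrite mulr_ge0_le0 ?mulr_ge0 ?subr_ge0 ?a_incr//.
  by rewrite -(diag (F k)); apply: H; apply: F0; exact: ltnW.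
have H5 : eps * (b k - b k.+1) * (D c d + e1 * (F k.+1 - c) + e2 * (F k.+1 - d)) <= 0.
  rewrite mulr_ge0_le0 ?mulr_ge0 ?subr_ge0 ?b_decr//.
  by rewrite -(diag (F k.+1)); apply: H; apply: F0.
have -> : D c d =
    eps * b k.+1 * (D c d + e1 * (F k.+2 - c) + e2 * (F k.+1 - d))
    + eps * a k * (D c d + e1 * (F k - c) + e2 * (F k.-1 - d))
    + (1 - eps * b k - eps * a k.+1) * (D c d + e1 * (F k.+1 - c) + e2 * (F k - d))
    + eps * (a k.+1 - a k) * (D c d + e1 * (F k - c) + e2 * (F k - d))
    + eps * (b k - b k.+1) * (D c d + e1 * (F k.+1 - c) + e2 * (F k.+1 - d)).
  by move: (D c d) => X; rewrite /c /d /P/=; ring.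
lra.
Qed.

(* Reversibility of the chain of edges. *)
Let edge_shift F :
  \sum_(k < M) pi k.+1 * a k.+1 *
    (b k.+1 * D (F k.+2) (F k.+1) + a k * D (F k) (F k.-1))
  = \sum_(k < M) pi k.+1 * a k.+1 * ((a k + b k.+1) * D (F k.+1) (F k)).
Proof.
have [N MN] : exists N, M = N.+1 by exists M.-1; rewrite prednK.
transitivity (\sum_(k < M) pi k.+1 * a k.+1 * (a k * D (F k.+1) (F k))
   + \sum_(k < M) pi k.+1 * a k.+1 * (b k.+1 * D (F k.+1) (F k))); last first.
  by rewrite -big_split/=; apply: eq_bigr => k _; ring.
under eq_bigr do rewrite mulrDr.
rewrite big_split/=; congr (_ + _); rewrite MN.
  rewrite big_ord_recr/= -MN bM mul0r mulr0 addr0 MN.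
  rewrite [RHS]big_ord_recl/= a0 mul0r mulr0 add0r.
  apply: eq_bigr => k _; rewrite /bump leq0n !add1n/=.
  have kM : (k.+1 < M)%N by rewrite MN ltnS.
  by rewrite (pi_rev kM); ring.
rewrite big_ord_recl/= a0 mul0r mulr0 add0r [RHS]big_ord_recr/= -MN bM mul0r mulr0 addr0.
apply: eq_bigr => k _; rewrite /bump leq0n !add1n/=.
have kM : (k.+1 < M)%N by rewrite MN ltnS.
by rewrite (pi_rev kM); ring.
Qed.

(** After [edge_shift] the edge (k, k + 1) receives the weight a k + b k.+1 and gives up a k.+1 + b
    k; the difference is the coalescence rate, at least [gamma]. *)
Let energy_step F : pos F -> energy (P F) <= (1 - eps * gamma) * energy F.
Proof.
move=> F0.
have rho0 k : (k < M)%N -> 0 <= pi k.+1 * a k.+1.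
  by move=> kM; rewrite mulr_ge0 ?a_ge0// ltW// pi_gt0.
apply: (@le_trans _ _ (\sum_(k < M) pi k.+1 * a k.+1 * (
  eps * b k.+1 * D (F k.+2) (F k.+1) + eps * a k * D (F k) (F k.-1)
     + (1 - eps * b k - eps * a k.+1) * D (F k.+1) (F k)))).
  by apply: ler_sum => k _; rewrite ler_wpM2l ?rho0 ?D_step.
have -> : \sum_(k < M) pi k.+1 * a k.+1 * (
  eps * b k.+1 * D (F k.+2) (F k.+1) + eps * a k * D (F k) (F k.-1)
     + (1 - eps * b k - eps * a k.+1) * D (F k.+1) (F k))
  = eps * (\sum_(k < M) pi k.+1 * a k.+1 *
    (b k.+1 * D (F k.+2) (F k.+1) + a k * D (F k) (F k.-1)))
   + \sum_(k < M) pi k.+1 * a k.+1 * ((1 - eps * b k - eps * a k.+1) * D (F k.+1) (F k)).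
  by rewrite mulr_sumr -big_split/=; apply: eq_bigr => k _; ring.
rewrite edge_shift !mulr_sumr -big_split/=; apply: ler_sum => k _.
have [kM e0] : (k < M)%N /\ 0 <= eps by split => //; exact: ltW.
have := mulr_ge0 (rho0 _ kM) (sym_bregman_ge0 (F0 _ kM) (F0 _ (ltnW kM))).
move: (pi k.+1 * a k.+1) (D _ _) => r d rd0.
have := ler_wpM2l (mulr_ge0 e0 rd0) (ab_incr kM).
lra.
Qed.

(** Induction on n: gamma times the entropy lost in a step is at most eps gamma energy F, exactly
    the amount by which [energy_step] lowers the bound. *)
Let entropy_iter F n : pos F ->
  gamma * (entropy F - entropy (iter n P F)) <= energy F.
Proof.
elim: n F => [|n IH] F F0.
  rewrite subrr mulr0 sumr_ge0// => k _.
  by rewrite mulr_ge0 ?sym_bregman_ge0 ?F0 ?mulr_ge0 ?a_ge0 ?(ltW (pi_gt0 _))// ltnW.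
rewrite iterSr.
have := IH _ (P_pos F0); have := ler_wpM2l (ltW gamma_gt0) (entropy_step F0).
have := energy_step F0; lra.
Qed.

Let eps_gamma : 0 <= 1 - eps * gamma < 1.
Proof.
apply/andP; split; last by rewrite ltrBlDr ltrDl mulr_gt0.
have := eps_edge M_gt0; have := ler_wpM2l (ltW eps_gt0) (ab_incr M_gt0).
rewrite a0 subr0.
have := mulr_ge0 (ltW eps_gt0) (b_ge0 M_gt0); lra.
Qed.

(** The same coupling contracts Lipschitz constants, so the iterates tend to a constant at a
    geometric rate; no separate ergodic theorem is required. *)
Let lip_step F l : (forall k, (k < M)%N -> `|F k.+1 - F k| <= l) ->
  forall k, (k < M)%N -> `|P F k.+1 - P F k| <= (1 - eps * gamma) * l.
Proof.
move=> H k kM; rewrite P_edge//.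
have e0 := ltW eps_gt0.
have l0 : 0 <= l by apply: le_trans (H _ kM).
apply: le_trans (ler_normD _ _) _; apply: le_trans (lerD (ler_normD _ _) (lexx _)) _.
rewrite !normrM (ger0_norm (eps_edge kM)) (ger0_norm e0).
rewrite (ger0_norm (b_ge0 kM)) (ger0_norm (a_ge0 (ltnW kM))).
have H1 : eps * b k.+1 * `|F k.+2 - F k.+1| <= eps * b k.+1 * l.
  move: (kM); rewrite leq_eqVlt => /predU1P[->|kM2]; first by rewrite bM mulr0 !mul0r.
  by rewrite ler_wpM2l ?H// mulr_ge0// b_ge0.
have H2 : eps * a k * `|F k - F k.-1| <= eps * a k * l.
  case: (k) kM => [|k'] kM; first by rewrite a0 mulr0 !mul0r.
  by rewrite ler_wpM2l ?H ?mulr_ge0 ?a_ge0 ?(ltnW kM)// ltnW.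
have H3 := ler_wpM2l (eps_edge kM) (H _ kM).
have := ler_wpM2l (mulr_ge0 e0 l0) (ab_incr kM).
lra.
Qed.

Let lip_osc F l : (forall k, (k < M)%N -> `|F k.+1 - F k| <= l) ->
  forall k, (k <= M)%N -> `|F k - F 0%N| <= k%:R * l.
Proof.
move=> H; elim=> [|k IH] kM; first by rewrite subrr normr0 mul0r.
rewrite -(subrKA (F k)); apply: le_trans (ler_normD _ _) _.
by rewrite -natr1 mulrDl mul1r addrC lerD ?H ?IH// ltnW.
Qed.

Let iter_sum F n :
  \sum_(k < M.+1) pi k * iter n P F k = \sum_(k < M.+1) pi k * F k.
Proof.
elim: n => //= n <-; apply/eqP; rewrite -subr_eq0 -sumrB; apply/eqP.
have := dirichlet (iter n P F) (fun=> 1).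
rewrite [X in _ = _ * X -> _]big1 => [|k _]; last by rewrite subrr mul0r mulr0.
by rewrite mulr0 => H; rewrite -[RHS]H; apply: eq_bigr => k _; ring.
Qed.

Lemma birth_death_entropy F : (forall k, (k <= M)%N -> 0 < F k) ->
  gamma * (\sum_(k < M.+1) pi k * Phi (F k) - (\sum_(k < M.+1) pi k)
      * Phi ((\sum_(k < M.+1) pi k * F k) / (\sum_(k < M.+1) pi k)))
  <= \sum_(k < M) pi k.+1 * a k.+1 * D (F k.+1) (F k).
Proof.
move=> F0; rewrite -/(entropy F) -/(energy F).
set mass := \sum_(k < M.+1) pi k; set mean := _ / mass.
have pi0 (k : 'I_M.+1) : 0 < pi k by rewrite pi_gt0// -ltnS.
have mass0 : 0 < mass.
  by rewrite /mass big_ord_recl ltr_pwDl// sumr_ge0// => k _; exact: ltW.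
have [lo lo0 loP] := lower F0; have [hi hiP] := upper F0.
(* All iterates stay between lo and hi and [dPhi] is nondecreasing, so B bounds [dPhi] along the
   whole evolution. The entropy left at time n is then at most mass times B times 2 L, where L
   decays geometrically. *)
pose B := `|dPhi lo| + `|dPhi hi|.
pose l := \sum_(k < M) `|F k.+1 - F k|.
apply: (@le_geometric_perturbation _ _ _
  (gamma * (mass * (B * (2 * M%:R * l)))) _ eps_gamma) => n.
set G := iter n P F.
have GF k : (k <= M)%N -> lo <= G k <= hi.
  rewrite /G; elim: (n) k => [|n' IH] k kM /=; first by rewrite loP ?hiP.
  exact: P_range.
have B0 : 0 <= B by rewrite addr_ge0.
have dG k : (k <= M)%N -> `|dPhi (G k)| <= B.
  move=> kM; have /andP[loG Ghi] := GF _ kM.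
  have H1 := dPhi_le lo0 loG; have H2 := dPhi_le (lt_le_trans lo0 loG) Ghi.
  have := ler_norm (dPhi hi); have := ler_norm (- dPhi lo); rewrite normrN => H3 H4.
  have := normr_ge0 (dPhi lo); have := normr_ge0 (dPhi hi) => H5 H6.
  by rewrite ler_norml /B; apply/andP; split; lra.
have lipG k : (k < M)%N -> `|G k.+1 - G k| <= (1 - eps * gamma) ^+ n * l.
  rewrite /G; elim: (n) k => [|n' IH] k kM /=.
    by rewrite expr0 mul1r /l (bigD1 (Ordinal kM))//= lerDl sumr_ge0.
  by rewrite exprS -mulrA; apply: lip_step.
set L := M%:R * ((1 - eps * gamma) ^+ n * l).
have l0 : 0 <= (1 - eps * gamma) ^+ n * l by apply: le_trans (lipG _ M_gt0).
have oscG k : (k <= M)%N -> `|G k - G 0%N| <= L.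
  move=> kM; apply: le_trans (lip_osc lipG kM) _.
  by rewrite ler_wpM2r// ler_nat.
have meanG : `|mean - G 0%N| <= L.
  have -> : mean - G 0%N = (\sum_(k < M.+1) pi k * (G k - G 0%N)) / mass.
    under eq_bigr do rewrite mulrBr.
    by rewrite sumrB -mulr_suml iter_sum -/mass mulrBl mulrAC mulfV ?mul1r// gt_eqF.
  have mV0 : 0 < mass^-1 by rewrite invr_gt0.
  rewrite normrM (gtr0_norm mV0) ler_pdivrMr//.
  apply: le_trans (ler_norm_sum _ _ _) _; rewrite mulrC /mass mulr_suml.
  apply: ler_sum => k _; rewrite normrM (gtr0_norm (pi0 k)) ler_wpM2l ?(ltW (pi0 k))//.
  by rewrite oscG// -ltnS.
have mean0 : 0 < mean.
  rewrite divr_gt0// big_ord_recl ltr_pwDl ?mulr_gt0 ?F0//.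
  by rewrite sumr_ge0// => k _; rewrite mulr_ge0 ?ltW// F0// -ltnS.
have HG : entropy G - mass * Phi mean <= mass * (B * (2 * L)).
  rewrite /entropy {1 2}/mass !mulr_suml -sumrB; apply: ler_sum => k _.
  have kM : (k <= M)%N by rewrite -ltnS.
  rewrite -mulrBr ler_pM2l//.
  have /andP[loG _] := GF _ kM.
  have H1 := Phi_tangent (lt_le_trans lo0 loG) mean0.
  have H2 : `|dPhi (G k) * (mean - G k)| <= B * (2 * L).
    rewrite normrM; apply: ler_pM => //; first exact: dG.
    rewrite -(subrKA (G 0%N)); apply: le_trans (ler_normD _ _) _.
    by rewrite mulr_natl mulr2n lerD// distrC oscG.
  have := ler_norm (- (dPhi (G k) * (mean - G k))); rewrite normrN => H3.
  lra.
have := entropy_iter n F0; rewrite -/G.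
have := ler_wpM2l (ltW gamma_gt0) HG; rewrite /L.
lra.
Qed.

End BirthDeath.

(** * Dynamics restricted to a set of sites *)

Section Reversibility.
Variables (R : realType) (n m : nat).
Variables (p : 'I_n -> R) (lambda : 'I_n -> nat -> R) (W : config n m -> R).
Hypothesis lambda0 : forall i, lambda i 0%N = 0.
Hypothesis detailed_balance : forall x i j, (0 < occ x i)%N ->
  W x * lambda i (occ x i) * p j
  = W (move x i j) * lambda j (occ (move x i j) j) * p i.
Implicit Types (x y : config n m) (T : {set 'I_n}) (i j : 'I_n)
  (f g : config n m -> R).

(** Detailed balance as a change of variables: [move] is a bijection from the configurations with a
    particle at i to those with one at j, and all others have rate 0. *)
Lemma sum_move_swap i j (h : config n m -> config n m -> R) :
  \sum_x W x * lambda i (occ x i) * p j * h x (move x i j)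
  = \sum_x W x * lambda j (occ x j) * p i * h (move x j i) x.
Proof.
rewrite (bigID (fun x => 0 < occ x i)%N)/= [X in _ + X]big1 ?addr0; last first.
  by move=> x; rewrite -eqn0Ngt => /eqP ->; rewrite lambda0 mulr0 !mul0r.
rewrite [RHS](bigID (fun x => 0 < occ x j)%N)/= [X in _ + X]big1 ?addr0; last first.
  by move=> x; rewrite -eqn0Ngt => /eqP ->; rewrite lambda0 mulr0 !mul0r.
rewrite (reindex_onto (fun y => move y j i) (fun x => move x i j)); last first.
  by move=> x; exact: moveK.
apply: eq_big => [x|x /andP[xi /eqP xE]].
  apply/andP/idP => [[xi /eqP xE]|xj].
    by rewrite -xE occ_move// eqxx; case: (eqVneq j i) xi => [<-|_] xi; lia.
  rewrite moveK// eqxx; split => //; rewrite occ_move// eqxx.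
  by case: (eqVneq i j) xj => [->|_] xj; lia.
by rewrite detailed_balance// xE.
Qed.

Definition subsystem_gen T f x := \sum_(i in T) \sum_(j in T)
  lambda i (occ x i) * p j * (f (move x i j) - f x).

Lemma gen_sym T f g :
  \sum_x W x * f x * subsystem_gen T g x = \sum_x W x * g x * subsystem_gen T f x.
Proof.
have E f' g' : \sum_x W x * f' x * subsystem_gen T g' x =
    \sum_(i in T) \sum_(j in T)
      (\sum_x W x * lambda i (occ x i) * p j * (f' x * g' (move x i j)) -
       \sum_x W x * lambda i (occ x i) * p j * (f' x * g' x)).
  under eq_bigr do rewrite mulr_sumr.
  rewrite exchange_big/=; apply: eq_bigr => i _.
  under eq_bigr do rewrite mulr_sumr.
  rewrite exchange_big/=; apply: eq_bigr => j _.
  rewrite -sumrB; apply: eq_bigr => x _; ring.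
rewrite !E.
under eq_bigr => i _.
  rewrite sumrB; under eq_bigr => j _.
    rewrite (sum_move_swap i j (fun x y => f x * g y)); over.
  over.
under [RHS]eq_bigr do rewrite sumrB.
rewrite !sumrB/=; congr (_ - _).
  rewrite exchange_big/=; apply: eq_bigr => i _; apply: eq_bigr => j _.
  by apply: eq_bigr => x _; ring.
by apply: eq_bigr => i _; apply: eq_bigr => j _; apply: eq_bigr => x _; ring.
Qed.

(** Carré du champ: expand the generator of the product f g, whose mean is 0 by symmetry against the
    constant 1. *)
Lemma gen_energy T f g : \sum_x W x * f x * subsystem_gen T g x = - 2^-1 *
  \sum_x \sum_(i in T) \sum_(j in T) W x * lambda i (occ x i) * p j
    * ((f (move x i j) - f x) * (g (move x i j) - g x)).
Proof.
pose h := fun x => f x * g x.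
have H : \sum_x W x * 1 * subsystem_gen T h x = 0.
  rewrite (gen_sym T (fun=> 1)) big1// => x _; rewrite /subsystem_gen big1 ?mulr0// => i _.
  by rewrite big1// => j _; rewrite subrr mulr0.
have {}H : \sum_x W x * subsystem_gen T h x = 0.
  by rewrite -[RHS]H; apply: eq_bigr => x _; rewrite mulr1.
have -> : \sum_x \sum_(i in T) \sum_(j in T) W x * lambda i (occ x i) * p j
    * ((f (move x i j) - f x) * (g (move x i j) - g x)) =
  \sum_x W x * subsystem_gen T h x
  - (\sum_x W x * f x * subsystem_gen T g x + \sum_x W x * g x * subsystem_gen T f x).
  rewrite -big_split -sumrB; apply: eq_bigr => x _; rewrite !mulr_sumr -big_split -sumrB.
  apply: eq_bigr => i _; rewrite !mulr_sumr -big_split -sumrB; apply: eq_bigr => j _.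
  by rewrite /h/=; ring.
by rewrite H (gen_sym T g f); field.
Qed.

End Reversibility.

Section ZeroRangeDynamics.
Variables (R : realType) (n m : nat).
Variables (p : 'I_n -> R) (lambda : 'I_n -> nat -> R) (delta Delta : R).
Variable W : config n m -> R.
Hypothesis p_gt0 : forall i, 0 < p i.
Hypothesis delta_gt0 : 0 < delta.
Hypothesis Delta_ge0 : 0 <= Delta.
Hypothesis lambda0 : forall i, lambda i 0%N = 0.
Hypothesis lambda_incr : forall i l, (l < m)%N ->
  delta <= lambda i l.+1 - lambda i l <= Delta.
Hypothesis W_gt0 : forall x, 0 < W x.
Hypothesis detailed_balance : forall x i j, (0 < occ x i)%N ->
  W x * lambda i (occ x i) * p j
  = W (move x i j) * lambda j (occ (move x i j) j) * p i.
Implicit Types (x y z : config n m) (S T : {set 'I_n}) (i j a b k : 'I_n)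
  (f g u : config n m -> R).

Lemma lambda_gt0 i l : (0 < l <= m)%N -> 0 < lambda i l.
Proof.
case: l => // l; elim: l => [|l IH] lm.
  have := lambda_incr i (l := 0) lm; rewrite lambda0 subr0 => /andP[+ _].
  exact: lt_le_trans.
have /andP[H _] := lambda_incr i lm; have := IH (ltnW lm) => H0.
by rewrite (lt_le_trans H0)// -subr_ge0 (le_trans _ H)// ltW.
Qed.

Lemma lambda_ge0 x i : 0 <= lambda i (occ x i).
Proof.
have [->|xi] := posnP (occ x i); first by rewrite lambda0.
by rewrite ltW// lambda_gt0// xi occ_le.
Qed.

(* [avg S f x] is the conditional expectation of f given the occupation numbers
   outside of S, evaluated at x. *)
Definition class_mass S x := \sum_(y | agree S x y) W y.
Definition avg S f x := (\sum_(y | agree S x y) W y * f y) / class_mass S x.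

Lemma class_mass_gt0 S x : 0 < class_mass S x.
Proof.
rewrite /class_mass (bigD1 x) ?agree_refl//=.
by rewrite ltr_pwDl// sumr_ge0// => y _; exact: ltW.
Qed.

Lemma class_mass_eq S x y : agree S x y -> class_mass S x = class_mass S y.
Proof. by move=> xy; apply: eq_bigl => z; rewrite (agree_eql _ xy). Qed.

Lemma avg_eq S f x y : agree S x y -> avg S f x = avg S f y.
Proof.
move=> xy; rewrite /avg (class_mass_eq xy); congr (_ / _).
by apply: eq_bigl => z; rewrite (agree_eql _ xy).
Qed.

Lemma eq_avg S f g x : (forall y, agree S x y -> f y = g y) ->
  avg S f x = avg S g x.
Proof.
by move=> fg; congr (_ / _); apply: eq_bigr => y /fg ->.
Qed.

Lemma ler_avg S f g x : (forall y, agree S x y -> f y <= g y) ->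
  avg S f x <= avg S g x.
Proof.
move=> fg; rewrite ler_pM2r ?invr_gt0 ?class_mass_gt0//.
by apply: ler_sum => y /fg H; rewrite ler_pM2l.
Qed.

Lemma avg_affine S (c0 c1 c2 : R) f g x :
  avg S (fun y => c0 + c1 * f y + c2 * g y) x
  = c0 + c1 * avg S f x + c2 * avg S g x.
Proof.
rewrite /avg; set Z := class_mass S x.
have Z0 : Z != 0 by rewrite gt_eqF// class_mass_gt0.
rewrite -[c0 in RHS](mulfK Z0) !mulrA -!mulrDl; congr (_ / _).
rewrite /Z /class_mass !mulr_sumr -!big_split/=; apply: eq_bigr => y _; ring.
Qed.

Lemma avgZ S (c : R) f x : avg S (fun y => c * f y) x = c * avg S f x.
Proof.
have := avg_affine S 0 c 0 f f x.
rewrite add0r mul0r addr0 => H; rewrite -[RHS]H.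
by apply: eq_avg => y _ /=; rewrite mul0r add0r addr0.
Qed.

Lemma avg_const S (c : R) x : avg S (fun=> c) x = c.
Proof.
have := avg_affine S c 0 0 (fun=> 0) (fun=> 0) x.
by rewrite !mul0r !addr0.
Qed.

Lemma avg_id S f x : (forall y, agree S x y -> f y = f x) -> avg S f x = f x.
Proof. by move=> H; rewrite -[RHS](avg_const S _ x); apply: eq_avg. Qed.

Lemma avg_gt0 S f x : (forall y, 0 < f y) -> 0 < avg S f x.
Proof.
move=> f0; apply: divr_gt0; last exact: class_mass_gt0.
rewrite (bigD1 x) ?agree_refl//= ltr_pwDl ?mulr_gt0//.
by rewrite sumr_ge0// => y _; rewrite mulr_ge0 ?ltW.
Qed.

Lemma sum_avg S f g : (forall x y, agree S x y -> g x = g y) ->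
  \sum_x W x * avg S f x * g x = \sum_x W x * f x * g x.
Proof.
move=> gS.
under eq_bigr do rewrite /avg mulrAC mulrA mulr_sumr mulr_suml.
rewrite (exchange_big_dep predT)//=; apply: eq_bigr => y _.
rewrite (eq_bigr (fun x => W y * f y * g y / class_mass S y * W x)); last first.
  move=> x xy; rewrite (class_mass_eq xy) (gS _ _ xy); ring.
rewrite -mulr_sumr (eq_bigl (agree S y)); last by move=> x; rewrite agree_sym.
by rewrite -/(class_mass S y) divfK// gt_eqF// class_mass_gt0.
Qed.

(** Testing stationarity of r with its own density g = r / W makes the Dirichlet form of g vanish.
    Hence g is unchanged by every possible jump, and irreducibility makes it constant on classes. *)
Lemma stationary_agree T (r : config n m -> R) :
  (forall g, \sum_x r x * subsystem_gen p lambda T g x = 0) ->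
  forall x y, agree T x y -> r x / W x = r y / W y.
Proof.
move=> rT; apply: (move_invariant_agree (u := fun x => r x / W x)).
move=> x i j iT jT xi.
pose g x := r x / W x.
have WgE z : W z * g z = r z by rewrite /g mulrC divfK// gt_eqF.
have := gen_energy lambda0 detailed_balance T g g.
under eq_bigr do rewrite WgE.
have term_ge0 y a b : 0 <= W y * lambda a (occ y a) * p b
    * ((g (move y a b) - g y) * (g (move y a b) - g y)).
  rewrite -expr2 mulr_ge0 ?sqr_ge0// mulr_ge0 ?(ltW (p_gt0 _))//.
  by rewrite mulr_ge0 ?lambda_ge0// ltW.
rewrite rT => /esym/eqP; rewrite mulf_eq0 oppr_eq0 invr_eq0 pnatr_eq0/= => /eqP.
move=> /psumr_eq0P/(_ x isT)H.
have {H}/psumr_eq0P/(_ i iT)H := H (fun y _ =>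
  sumr_ge0 _ (fun a _ => sumr_ge0 _ (fun b _ => term_ge0 y a b))).
have {H}/psumr_eq0P/(_ j jT)H := H (fun a _ => sumr_ge0 _ (fun b _ => term_ge0 x a b)).
have /eqP := H (fun b _ => term_ge0 x i b).
have lx : 0 < lambda i (occ x i) by rewrite lambda_gt0// xi occ_le.
rewrite 3!mulf_eq0 (gt_eqF (W_gt0 _)) (gt_eqF (p_gt0 _)) (gt_eqF lx)/=.
by rewrite -expr2 sqrf_eq0 subr_eq0 => /eqP.
Qed.

Lemma stationary_avg T (r : config n m -> R) x0 :
  (forall g, \sum_x r x * subsystem_gen p lambda T g x = 0) ->
  \sum_(x | agree T x0 x) r x = 1 ->
  forall x, agree T x0 x -> r x = W x / class_mass T x0.
Proof.
move=> rT r1 x x0x.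
have E y : agree T x0 y -> r y = r x0 / W x0 * W y.
  by move=> /(stationary_agree rT) ->; rewrite divfK// gt_eqF.
move: r1; rewrite (eq_bigr _ E) -mulr_sumr -/(class_mass T x0) => H.
have Z0 : class_mass T x0 != 0 by rewrite gt_eqF// class_mass_gt0.
by rewrite (E _ x0x) -[r x0 / W x0](mulfK Z0) H mul1r mulrC.
Qed.

(* A pair (x, j) stands for the configuration x together with a second-class
   particle at j: x is stationary with one particle fewer on T than the
   configuration [move x i j], which is stationary as well.  K is the conditional
   law of j given x; its density with respect to p is bounded by evaluating the
   stationarity equation where K _ j is maximal. *)
Lemma second_class_coupling T i j0 x0 : i \notin T -> j0 \in T -> (0 < occ x0 i)%N ->
  exists K : config n m -> 'I_n -> R, [/\
    forall x j, 0 <= K x j,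
    forall x, agree T x0 x -> \sum_(j in T) K x j = 1,
    forall x j, agree T x0 x -> j \in T ->
      delta * (\sum_(b in T) p b) * K x j <= Delta * p j &
    forall f, avg T f (move x0 i j0)
              = avg T (fun x => \sum_(j in T) K x j * f (move x i j)) x0].
Proof.
move=> iT j0T xi0.
have occ_i x : agree T x0 x -> occ x i = occ x0 i.
  by move=> /agreeP/(_ i iT).
have occ_i_gt0 x : agree T x0 x -> (0 < occ x i)%N by move=> /occ_i ->.
pose A (w : config n m * 'I_n) := agree T x0 w.1 && (w.2 \in T).
pose r x j := lambda j (occ x j).+1 - lambda j (occ x j).
(* The increment bounds require occ x j < m, which holds because the site i outside of T is
   occupied. *)
have rP x j : A (x, j) -> delta <= r x j <= Delta.
  move=> /andP[/= x0x jT]; apply: lambda_incr.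
  by apply: (@occ_lt _ _ _ i); [apply: contraNneq iT => ->|exact: occ_i_gt0].
(* Ordinary particles jump without noticing the second-class one, which jumps from j at the
   increment rate [r]. The guard [A w] keeps all rates nonnegative. *)
pose c (w : config n m * 'I_n) (e : ('I_n * 'I_n) + 'I_n) : R :=
  match e with
  | inl ab => if (ab.1 \in T) && (ab.2 \in T)
              then lambda ab.1 (occ w.1 ab.1) * p ab.2 else 0
  | inr b => if (b \in T) && A w then r w.1 w.2 * p b else 0
  end.
pose tau (w : config n m * 'I_n) (e : ('I_n * 'I_n) + 'I_n) :=
  match e with
  | inl ab => (move w.1 ab.1 ab.2, w.2)
  | inr b => (w.1, b)
  end.
have [|||pi [pi0 piA pi1 piQ]] := @stationary_measure_closed R _ _ A (x0, j0) c tau.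
- by rewrite /A/= agree_refl.
- move=> [x j] [[a b]|b] /=.
    by case: ifP => // _; rewrite mulr_ge0 ?lambda_ge0// ltW.
  case: ifP => // /andP[bT /rP/andP[r0 _]].
  by rewrite mulr_ge0 ?(ltW (p_gt0 _))// (le_trans _ r0)// ltW.
- move=> [x j] [[a b]|b] /andP[/= x0x jT].
    case: ifP => [/andP[aT bT]|_]; last by rewrite eqxx.
    have [xa|xa] := posnP (occ x a); first by rewrite xa lambda0 mul0r eqxx.
    move=> _; rewrite /A/= jT andbT; apply: agree_trans x0x _.
    exact: agree_move.
  by case: ifP => [/andP[bT _]|_]; rewrite ?eqxx// /A/= bT x0x.
have sum_pi (F : config n m -> 'I_n -> R) :
    \sum_w pi w * F w.1 w.2 = \sum_x \sum_(j in T) pi (x, j) * F x j.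
  rewrite (eq_bigr (fun w => pi (w.1, w.2) * F w.1 w.2)); last by case.
  rewrite -(pair_bigA _ (fun x j => pi (x, j) * F x j))/=.
  apply: eq_bigr => x _; rewrite [RHS]big_mkcond/=; apply: eq_bigr => j _.
  by case: ifPn => // jT; rewrite piA ?mul0r// /A negb_and jT orbT.
have piE (phi : config n m -> 'I_n -> R) :
    \sum_x \sum_(j in T) pi (x, j) * (subsystem_gen p lambda T (phi^~ j) x
      + \sum_(b in T) r x j * p b * (phi x b - phi x j)) = 0.
  rewrite -(sum_pi (fun x j => subsystem_gen p lambda T (phi^~ j) x
      + \sum_(b in T) r x j * p b * (phi x b - phi x j))).
  rewrite -[RHS](piQ (fun w => phi w.1 w.2)); apply: eq_bigr => -[x j] _ /=.
  case: (boolP (A (x, j))) => Axj; last by rewrite piA// !mul0r.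
  congr (_ * _); rewrite big_sumType/=; congr (_ + _).
    rewrite /subsystem_gen -(pair_bigA _ (fun a b => (if (a \in T) && (b \in T)
      then lambda a (occ x a) * p b else 0) * (phi (move x a b) j - phi x j)))/=.
    rewrite [LHS]big_mkcond/=; apply: eq_bigr => a _.
    case: (a \in T) => /=; last by rewrite big1// => b _; rewrite mul0r.
    rewrite [LHS]big_mkcond/=; apply: eq_bigr => b _.
    by case: ifP => // _; rewrite mul0r.
  rewrite [LHS]big_mkcond/=; apply: eq_bigr => b _.
  by rewrite Axj andbT; case: ifP => // _; rewrite mul0r.
have pi_out x j : ~~ agree T x0 x -> pi (x, j) = 0.
  by move=> H; rewrite piA// /A negb_and H.
pose r1 x := \sum_(j in T) pi (x, j).
have r1_sum : \sum_(x | agree T x0 x) r1 x = 1.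
  rewrite -pi1 (eq_bigr (fun w => pi w * 1)) => [|w _]; last by rewrite mulr1.
  rewrite (sum_pi (fun _ _ => 1)) [RHS](bigID (agree T x0))/=.
  rewrite [X in _ = _ + X]big1 ?addr0; last first.
    by move=> x Hx; rewrite big1// => j _; rewrite pi_out// mul0r.
  by apply: eq_bigr => x _; apply: eq_bigr => j _; rewrite mulr1.
have r1E x : agree T x0 x -> r1 x = W x / class_mass T x0.
  apply: stationary_avg r1_sum x => g.
  rewrite -[RHS](piE (fun x _ => g x)); apply: eq_bigr => x _.
  rewrite /r1 mulr_suml; apply: eq_bigr => j _.
  rewrite [X in _ + X]big1 ?addr0// => b _; by rewrite subrr mulr0.
pose z0 := move x0 i j0.
pose r2 z := \sum_x \sum_(j in T) pi (x, j) * (move x i j == z)%:R.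
have r2_sum (f : config n m -> R) : \sum_z r2 z * f z
    = \sum_x \sum_(j in T) pi (x, j) * f (move x i j).
  under eq_bigr do rewrite mulr_suml.
  rewrite exchange_big/=; apply: eq_bigr => x _.
  under eq_bigr do rewrite mulr_suml.
  rewrite exchange_big/=; apply: eq_bigr => j _.
  rewrite (bigD1 (move x i j))//= eqxx mulr1 big1 ?addr0// => z /negbTE zE.
  by rewrite eq_sym zE mulr0 mul0r.
have r2_out z : ~~ agree T z0 z -> r2 z = 0.
  move=> Hz; rewrite /r2 big1// => x _; rewrite big1// => j jT.
  case: (boolP (agree T x0 x)) => Hx; last by rewrite pi_out// mul0r.
  case: eqP => [xz|]; last by rewrite mulr0.
  by case/negP: Hz; rewrite -xz; apply: agree_move2 => //; exact: occ_i_gt0.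
have r2_class (f : config n m -> R) :
    \sum_(z | agree T z0 z) r2 z * f z = \sum_z r2 z * f z.
  rewrite [RHS](bigID (agree T z0))/= [X in _ = _ + X]big1 ?addr0// => z Hz.
  by rewrite r2_out// mul0r.
(* With the second-class particle counted as ordinary, lambda_j(x_j) and [r x j] add up to
   lambda_j(x_j + 1), so [move x i j] follows the dynamics on T as well; the particle lost at i is
   not seen by T. Uniqueness of the stationary law identifies [r2]. *)
have r2E z : agree T z0 z -> r2 z = W z / class_mass T z0.
  apply: stationary_avg => [g|]; last first.
    rewrite (eq_bigr (fun z => r2 z * 1)) => [|w _]; last by rewrite mulr1.
    rewrite (r2_class (fun=> 1)) (r2_sum (fun=> 1)) -[RHS]pi1.
    rewrite [RHS](eq_bigr (fun w => pi w * 1)) => [|w _]; last by rewrite mulr1.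
    by rewrite (sum_pi (fun _ _ => 1)).
  rewrite r2_sum -[RHS](piE (fun x j => g (move x i j))).
  apply: eq_bigr => x _; apply: eq_bigr => j jT.
  case: (boolP (agree T x0 x)) => Hx; last by rewrite pi_out// !mul0r.
  have xi := occ_i_gt0 x Hx.
  have ij : (i == j) = false by apply: contraNF iT => /eqP ->.
  congr (_ * _); rewrite /subsystem_gen (bigD1 j)//= [X in _ = X + _](bigD1 j)//=.
  rewrite addrAC -big_split/=; congr (_ + _).
    apply: eq_bigr => b bT.
    rewrite move_move// occ_move// eqxx eq_sym ij subn0 addn1.
    have [xj|xj] := posnP (occ x j); last first.
      by rewrite (@move_swap _ _ x j b i j) ?(eq_sym j) ?ij// move_move// /r; ring.
    by rewrite /r xj lambda0; ring.
  apply: eq_bigr => a /andP[aT aj]; apply: eq_bigr => b bT.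
  have ai : (a == i) = false by apply: contraNF iT => /eqP <-.
  rewrite occ_move// (negbTE aj) ai addn0 subn0.
  have [->|xa] := posnP (occ x a); first by rewrite lambda0 !mul0r.
  by rewrite (@move_swap _ _ x i j a b)// eq_sym ai.
have Z0 := class_mass_gt0 T x0.
pose K x j := pi (x, j) * (class_mass T x0 / W x).
have WK x j : W x * K x j = pi (x, j) * class_mass T x0.
  by rewrite /K; field; rewrite gt_eqF.
exists K; split.
- by move=> x j; rewrite mulr_ge0// divr_ge0// ltW.
- move=> x x0x; rewrite -mulr_suml -/(r1 x) r1E//.
  by field; rewrite !gt_eqF.
- move=> x l x0x lT.
  pose pT := \sum_(b in T) p b.
  have pT0 : 0 <= pT by apply: sumr_ge0 => b _; exact: ltW.
  have [xm _ xmP] : exists2 xm, true & forall y, K y l <= K xm l.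
    exists [arg max_(y > x0) K y l]%O => // y.
    by case: arg_maxP => // z _ H; exact: H.
  have dp : 0 <= delta * pT by rewrite mulr_ge0// ltW.
  apply: le_trans (ler_wpM2l dp (xmP x)) _.
  have Dpl : 0 <= Delta * p l by rewrite mulr_ge0// ltW.
  case: (boolP (agree T x0 xm)) => Hxm; last first.
    by rewrite /K pi_out// mul0r mulr0.
  pose psi x : R := (x == xm)%:R.
  (* Mass balance at the state (xm, l): the second-class particle enters l from j at rate r xm j p l
     and leaves at rate r xm l p(T), jumps from l to itself counting in both. *)
  have := piE (fun x j => psi x * (j == l)%:R).
  have -> : \sum_x \sum_(j in T) pi (x, j) *
      (subsystem_gen p lambda T (fun x => psi x * (j == l)%:R) x
      + \sum_(b in T) r x j * p b * (psi x * (b == l)%:R - psi x * (j == l)%:R))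
    = \sum_x pi (x, l) * subsystem_gen p lambda T psi x
      + (p l * \sum_(j in T) pi (xm, j) * r xm j - pT * (pi (xm, l) * r xm l)).
    have step y j : subsystem_gen p lambda T (fun x => psi x * (j == l)%:R) y
        + \sum_(b in T) r y j * p b * (psi y * (b == l)%:R - psi y * (j == l)%:R)
      = (j == l)%:R * subsystem_gen p lambda T psi y
        + psi y * (p l * r y j - (j == l)%:R * (pT * r y j)).
      congr (_ + _).
        rewrite /subsystem_gen mulr_sumr; apply: eq_bigr => a _; rewrite mulr_sumr.
        by apply: eq_bigr => b _; ring.
      rewrite /pT; under eq_bigr do rewrite mulrBr.
      rewrite sumrB (bigD1 l)//= eqxx mulr1 [X in _ + X - _]big1 ?addr0; last first.
        by move=> b /andP[_ /negbTE ->]; rewrite !mulr0.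
      by rewrite -mulr_suml -mulr_sumr; ring.
    transitivity (\sum_y (
        \sum_(j in T) pi (y, j) * ((j == l)%:R * subsystem_gen p lambda T psi y)
        + \sum_(j in T) pi (y, j) * (psi y * (p l * r y j - (j == l)%:R * (pT * r y j))))).
      apply: eq_bigr => y _; rewrite -big_split/=; apply: eq_bigr => j _.
      by rewrite step mulrDr.
    rewrite big_split/=; congr (_ + _).
      apply: eq_bigr => y _; rewrite (bigD1 l)//= eqxx mul1r big1 ?addr0//.
      by move=> j /andP[_ /negbTE ->]; rewrite mul0r mulr0.
    rewrite (bigD1 xm)//= [X in _ + X]big1 ?addr0; last first.
      by move=> y /negbTE yxm; rewrite big1// => j _; rewrite /psi yxm mul0r mulr0.
    rewrite /psi eqxx; under eq_bigr do rewrite mul1r mulrBr.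
    rewrite sumrB; congr (_ - _).
      by rewrite mulr_sumr; apply: eq_bigr => j _; ring.
    rewrite (bigD1 l)//= eqxx mul1r big1 ?addr0; first by ring.
    by move=> j /andP[_ /negbTE ->]; rewrite mul0r mulr0.
  (* By symmetry the generator can be applied to K _ l instead of the indicator, and it is
     nonpositive at a maximum point. *)
  have Kgen : \sum_x pi (x, l) * subsystem_gen p lambda T psi x <= 0.
    have -> : \sum_x pi (x, l) * subsystem_gen p lambda T psi x
        = (class_mass T x0)^-1 * \sum_x W x * K x l * subsystem_gen p lambda T psi x.
      rewrite mulr_sumr; apply: eq_bigr => y _; rewrite WK.
      by field; rewrite gt_eqF.
    rewrite (gen_sym lambda0 detailed_balance) mulr_ge0_le0 ?invr_ge0 ?(ltW Z0)//.
    rewrite (bigD1 xm)//= big1 => [|y /negbTE yxm]; last by rewrite /psi yxm mulr0 mul0r.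
    rewrite addr0 /psi eqxx mulr1 mulr_ge0_le0 ?(ltW (W_gt0 _))//.
    apply: sumr_le0 => a _; apply: sumr_le0 => b _; apply: mulr_ge0_le0.
      by rewrite mulr_ge0 ?lambda_ge0// ltW.
    by rewrite subr_le0.
  have rxl : pi (xm, l) * delta <= pi (xm, l) * r xm l.
    have /andP[d0 _] := rP xm l (introT andP (conj Hxm lT)).
    by rewrite ler_wpM2l.
  have rxj : \sum_(j in T) pi (xm, j) * r xm j <= r1 xm * Delta.
    rewrite mulr_suml; apply: ler_sum => j jT.
    have /andP[_ d1] := rP xm j (introT andP (conj Hxm jT)).
    by rewrite ler_wpM2l.
  rewrite r1E// in rxj; move=> E.
  have : pT * (pi (xm, l) * delta) <= p l * (W xm / class_mass T x0 * Delta).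
    have := ler_wpM2l pT0 rxl; have := ler_wpM2l (ltW (p_gt0 l)) rxj.
    move: E Kgen; set X := \sum_x _; set Y := \sum_(j in T) _.
    lra.
  rewrite /K => H.
  have q0 : 0 <= class_mass T x0 / W xm by rewrite divr_ge0// ltW.
  have := ler_wpM2r q0 H; congr (_ <= _); first by rewrite /pT; ring.
  by field; rewrite !gt_eqF.
- move=> f.
  rewrite /avg.
  transitivity (\sum_(z | agree T z0 z) r2 z * f z).
    rewrite mulr_suml; apply: eq_bigr => z Hz; rewrite r2E// mulrAC //.
  rewrite r2_class r2_sum [LHS](bigID (agree T x0))/= [X in _ + X]big1 ?addr0; last first.
    by move=> x Hx; rewrite big1// => j _; rewrite pi_out// mul0r.
  rewrite mulr_suml; apply: eq_bigr => x Hx; rewrite mulr_sumr mulr_suml.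
  apply: eq_bigr => j _; rewrite mulrA WK.
  by field; rewrite gt_eqF.
Qed.

(** * Entropy inequality by induction on the set of sites *)

Variables Phi dPhi : R -> R.
Hypothesis Phi_tangent : forall x y : R, 0 < x -> 0 < y ->
  Phi x + dPhi x * (y - x) <= Phi y.
Local Notation D := (sym_bregman dPhi).
Hypothesis D_tangent : forall c d : R, 0 < c -> 0 < d ->
  exists e1 e2, forall a b : R, 0 < a -> 0 < b ->
    D c d + e1 * (a - c) + e2 * (b - d) <= D a b.

Let D_ge0 (x y : R) : 0 < x -> 0 < y -> 0 <= D x y.
Proof. exact: (sym_bregman_ge0 Phi_tangent). Qed.

Lemma D_avg_le T i j0 x f : i \notin T -> j0 \in T -> (0 < occ x i)%N ->
  (forall y, 0 < f y) ->
  delta * (\sum_(j in T) p j) * D (avg T f x) (avg T f (move x i j0))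
  <= Delta * avg T (fun y => \sum_(j in T) p j * D (f y) (f (move y i j))) x.
Proof.
move=> iT j0T xi f0.
have [K [K0 K1 Kle Kavg]] := second_class_coupling iT j0T xi.
have [e1 [e2 H]] := D_tangent (avg_gt0 T x f0) (avg_gt0 T (move x i j0) f0).
set c := avg T f x in H *; set d := avg T f (move x i j0) in H *.
set pT := \sum_(j in T) p j in Kle *.
have pT0 : 0 <= delta * pT.
  by rewrite mulr_ge0 ?(ltW delta_gt0)// sumr_ge0// => k _; exact: ltW.
clearbody pT.
(* The tangent plane of D at the two averages, evaluated along the coupling. Its average is D c d
   because the coupling has the correct marginals. *)
pose L y := D c d + e1 * (f y - c) + e2 * (\sum_(j in T) K y j * f (move y i j) - d).
have LE : avg T L x = D c d.
  rewrite (eq_avg (g := fun y => (D c d - e1 * c - e2 * d) + e1 * f y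
    + e2 * (\sum_(j in T) K y j * f (move y i j)))); last first.
    by move=> y _; rewrite /L; ring.
  by rewrite avg_affine -Kavg -/c -/d; ring.
rewrite -LE -!avgZ; apply: ler_avg => y xy.
have -> : L y = \sum_(j in T) K y j * (D c d + e1 * (f y - c) + e2 * (f (move y i j) - d)).
  transitivity ((\sum_(j in T) K y j) * (D c d + e1 * (f y - c) - e2 * d)
    + e2 * (\sum_(j in T) K y j * f (move y i j))).
    by rewrite K1// /L; ring.
  by rewrite mulr_suml mulr_sumr -big_split/=; apply: eq_bigr => j _; ring.
rewrite !mulr_sumr; apply: ler_sum => j jT.
apply: (@le_trans _ _ (delta * pT * (K y j * D (f y) (f (move y i j))))).
  by apply: ler_wpM2l => //; apply: ler_wpM2l => //; exact: H.
rewrite [leLHS]mulrA [leRHS]mulrA; apply: ler_wpM2r; [exact: D_ge0|exact: Kle].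
Qed.

(** Replacing each function by its average sums over the classes without choosing
    representatives. *)
Lemma ler_sum_class S (phi psi : config n m -> R) :
  (forall x0, \sum_(x | agree S x0 x) W x * phi x
           <= \sum_(x | agree S x0 x) W x * psi x) ->
  \sum_x W x * phi x <= \sum_x W x * psi x.
Proof.
move=> H.
have E (g : config n m -> R) : \sum_x W x * g x = \sum_x W x * avg S g x.
  have := @sum_avg S g (fun=> 1) (fun _ _ _ => erefl).
  by under eq_bigr do rewrite mulr1; under [RHS]eq_bigr do rewrite mulr1.
rewrite (E phi) (E psi); apply: ler_sum => x _; apply: ler_wpM2l; first exact: ltW.
by rewrite /avg ler_pM2r ?H// invr_gt0 class_mass_gt0.
Qed.

Lemma site_entropy_class S i j0 f x0 :
  i \in S -> j0 \in (S :\ i)%SET -> (forall y, 0 < f y) ->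
  \sum_(x | agree S x0 x) W x * (delta * (\sum_(k in S) p k)
      * (Phi (avg (S :\ i) f x) - Phi (avg S f x)))
  <= \sum_(x | agree S x0 x) W x * (lambda i (occ x i) * (\sum_(k in (S :\ i)%SET) p k)
      * D (avg (S :\ i) f x) (avg (S :\ i) f (move x i j0))).
Proof.
move=> iS j0T f0; set T := (S :\ i)%SET.
have TS : T \subset S by exact: subD1set.
have iT : i \notin T by rewrite !inE eqxx.
have ij0 : i != j0 by apply: contraNneq iT => ->.
have j0S : j0 \in S by exact: (fintype.subsetP TS).
pose xm := [arg max_(x > x0 | agree S x0 x) occ x i].
have [xmS xmP] : agree S x0 xm /\ forall x, agree S x0 x -> (occ x i <= occ xm i)%N.
  by rewrite /xm; case: arg_maxnP => [|z H1 H2]; [exact: agree_refl|].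
clearbody xm; set M := occ xm i in xmP.
(* Moving M - k particles from i to j0 gives a representative of the level {X_i = k}; by [levelE]
   that level is a single class for T. *)
pose z (k : nat) := iter (M - k) (fun x => move x i j0) xm.
have zS (k : nat) : (k < M)%N -> z k = move (z k.+1) i j0.
  by move=> kM; rewrite /z -(subnSK kM).
have zP (k : nat) : (k <= M)%N -> occ (z k) i = k /\ agree S x0 (z k).
  move=> kM; rewrite -(subKn kM); elim: (M - k)%N (leq_subr k M) => [|l IH] lM.
    by rewrite subn0 /z subnn.
  have [|o1 a1] := IH; first exact: ltnW.
  have kE : (M - l = (M - l.+1).+1)%N by rewrite subnSK.
  have o2 : (0 < occ (z (M - l)) i)%N by rewrite o1 kE.
  rewrite zS -?kE; last exact: leq_subr.
  split; last by apply: agree_trans a1 _; exact: agree_move.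
  by rewrite occ_move// o1 eqxx (negbTE ij0) addn0 subn1 subnS.
have zi (k : nat) : (k <= M)%N -> occ (z k) i = k by case/zP.
have levelE (k : nat) : (k <= M)%N -> forall x,
    (agree S x0 x && (occ x i == k)) = agree T (z k) x.
  move=> kM x; have [zk az] := zP _ kM; apply/andP/idP => [[ax /eqP xk]|ax].
    apply/agreeP => l; rewrite !inE negb_and negbK => /orP[/eqP ->|lS].
      by rewrite xk zk.
    by rewrite -(agreeP _ _ _ az) ?(agreeP _ _ _ ax).
  split; first by apply: agree_trans az _; exact: agree_sub ax.
  by rewrite -(agreeP _ _ _ ax)// zk.
have split_class (psi : config n m -> R) : \sum_(x | agree S x0 x) psi x
    = \sum_(k < M.+1) \sum_(x | agree T (z k) x) psi x.
  rewrite (partition_big (fun x => inord (occ x i) : 'I_M.+1) predT)//=.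
  apply: eq_bigr => k _; apply: eq_bigl => x; rewrite -levelE; last by rewrite -ltnS.
  apply: andb_id2l => /xmP xM; apply/eqP/eqP => [<-|xk]; first by rewrite inordK.
  by apply: val_inj; rewrite /= inordK// xk.
pose pi (k : nat) := class_mass T (z k); pose F (k : nat) := avg T f (z k).
(* The death rate depends on X_i alone. The birth rate depends on the whole configuration on T, so
   [b] averages it over the level. *)
pose a (k : nat) := lambda i k * \sum_(l in T) p l.
pose b (k : nat) := p i * avg T (fun x => \sum_(j in T) lambda j (occ x j)) (z k).
have avgF (k : nat) x : agree T (z k) x -> avg T f x = F k by move=> /(avg_eq f) <-.
have sumF (k : nat) (g : config n m -> R) :
    \sum_(x | agree T (z k) x) W x * g x = pi k * avg T g (z k).
  by rewrite /avg /pi mulrC divfK// gt_eqF// class_mass_gt0.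
have piF (k : nat) : pi k * F k = \sum_(x | agree T (z k) x) W x * f x by rewrite sumF.
have meanE x : agree S x0 x -> avg S f x
    = (\sum_(k < M.+1) pi k * F k) / \sum_(k < M.+1) pi k.
  move=> /(avg_eq f) <-; rewrite /avg {1}/class_mass !split_class; congr (_ / _).
  by apply: eq_bigr => k _; rewrite piF.
have pi_gt0 (k : nat) : 0 < pi k by exact: class_mass_gt0.
have M_le : (M <= m)%N by exact: occ_le.
have F_gt0 (k : nat) : 0 < F k by exact: avg_gt0.
have -> : \sum_(x | agree S x0 x) W x * (delta * (\sum_(k in S) p k)
      * (Phi (avg T f x) - Phi (avg S f x)))
  = delta * (\sum_(k in S) p k) * (\sum_(k < M.+1) pi k * Phi (F k)
     - (\sum_(k < M.+1) pi k) * Phi ((\sum_(k < M.+1) pi k * F k)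
                                      / (\sum_(k < M.+1) pi k))).
  set mean := (\sum_(k < M.+1) pi k * F k) / _ in meanE *.
  set dpS := delta * _.
  rewrite mulr_suml -sumrB mulr_sumr split_class; apply: eq_bigr => k _.
  rewrite -mulrBr mulrCA {1}/pi /class_mass mulr_suml; apply: eq_bigr => x kx.
  rewrite (avgF _ _ kx) meanE//.
  by have := levelE k (ltn_ord k) x; rewrite kx => /andP[].
have -> : \sum_(x | agree S x0 x) W x * (lambda i (occ x i) * (\sum_(k in T) p k)
      * D (avg T f x) (avg T f (move x i j0)))
  = \sum_(k < M) pi k.+1 * a k.+1 * D (F k.+1) (F k).
  rewrite split_class big_ord_recl/= big1 ?add0r; last first.
    move=> x; rewrite -levelE// => /andP[_ /eqP ->].
    by rewrite lambda0 !mul0r mulr0.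
  apply: eq_bigr => k _; rewrite /bump leq0n add1n.
  rewrite {1}/pi /class_mass !mulr_suml; apply: eq_bigr => x kx.
  have xk : occ x i = k.+1.
    by move: kx; rewrite -levelE// => /andP[_ /eqP].
  rewrite (avgF _ _ kx) xk (avgF k); first by rewrite /a; ring.
  rewrite zS//; apply: agree_move2 => //; last by rewrite xk.
  by rewrite zi.
have [M0|M0] := posnP M.
  have FE : pi 0%N * F 0%N / pi 0%N = F 0%N by rewrite mulrAC mulfV ?mul1r// gt_eqF.
  by rewrite M0 !big_ord1 big_ord0 FE subrr mulr0.
have pT0 : 0 <= \sum_(k in T) p k by apply: sumr_ge0 => k _; exact: ltW.
have sumS : \sum_(k in S) p k = p i + \sum_(k in T) p k by rewrite (big_setD1 i).
(* Lowering X_i from k + 1 to k puts one more particle on T; in the coupling it sits at j and raises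
   the total rate of T by at least delta. *)
have b_step (k : nat) : (k < M)%N -> p i * delta <= b k - b k.+1.
  move=> kM; have k1 : (0 < occ (z k.+1) i)%N by rewrite zi.
  have [K [K0 K1 Kle Kavg]] := second_class_coupling iT j0T k1.
  rewrite /b -mulrBr ler_wpM2l ?(ltW (p_gt0 _))//.
  rewrite [z k]zS// Kavg lerBrDl.
  pose rate x := \sum_(j in T) lambda j (occ x j).
  rewrite -/rate -[delta]mul1r.
  have := avg_affine T delta 1 0 rate rate (z k.+1).
  rewrite mul1r mul0r addr0 (addrC delta) mul1r => <-; apply: ler_avg => y ky.
  rewrite mul1r mul0r addr0 -[_ + rate y]mul1r -(K1 y ky) mulr_suml.
  apply: ler_sum => j jT; apply: ler_wpM2l => //.
  have yk : occ y i = k.+1 by rewrite -(agreeP _ _ _ ky)// zi.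
  have yi : (0 < occ y i)%N by rewrite yk.
  have ij : (j == i) = false by apply: contraNF iT => /eqP <-.
  rewrite /rate (bigD1 j)//= [X in _ <= X](bigD1 j)//= addrA.
  rewrite occ_move// eqxx ij subn0 addn1; apply: lerD.
    have /andP[+ _] := lambda_incr j (occ_lt (negbT (eq_trans (eq_sym i j) ij)) yi).
    by lra.
  apply: ler_sum => l /andP[lT lj]; rewrite occ_move// (negbTE lj).
  have -> : (l == i) = false by apply: contraNF iT => /eqP <-.
  by rewrite addn0 subn0.
have a_step (k : nat) : (k < M)%N -> delta * \sum_(k in T) p k <= a k.+1 - a k.
  move=> kM; rewrite /a -mulrBl ler_wpM2r//.
  by have /andP[] := lambda_incr i (leq_trans kM M_le).
have pid : 0 < p i * delta by rewrite mulr_gt0.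
have dpT : 0 <= delta * \sum_(k in T) p k by rewrite mulr_ge0// ltW.
apply: (birth_death_entropy Phi_tangent D_tangent (b := b)) => //.
- by rewrite sumS mulr_gt0// ltr_pwDl.
- by rewrite /a lambda0 mul0r.
(* On the top level T is empty: moving one of its particles to i would exceed the maximum M. *)
- rewrite /b [avg T _ _](_ : _ = 0) ?mulr0//.
  rewrite -[RHS](avg_const T 0 (z M)); apply: eq_avg => y; rewrite -levelE//.
  move=> /andP[ay /eqP yM]; apply: big1 => j jT.
  have [->|yj] := posnP (occ y j); first exact: lambda0.
  have jS : j \in S by exact: (fintype.subsetP TS).
  have /xmP : agree S x0 (move y j i) by apply: agree_trans ay _; exact: agree_move.
  rewrite occ_move// eqxx yM.
  have -> : (i == j) = false by apply: contraNF iT => /eqP ->.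
  by rewrite subn0 addn1 ltnn.
(* Detailed balance of the averaged chain is [sum_move_swap] for the indicator of level k + 1,
   summed over j in T. *)
- move=> k kM; rewrite /b [RHS]mulrCA -sumF.
  transitivity (\sum_(j in T) \sum_x W x * lambda i (occ x i) * p j
      * (agree T (z k.+1) x)%:R).
    rewrite exchange_big/= /pi /class_mass mulr_suml big_mkcond/=.
    apply: eq_bigr => x _; case: ifP => zx; last by rewrite big1// => j _; rewrite mulr0.
    have xk : occ x i = k.+1 by move: zx; rewrite -levelE// => /andP[_ /eqP].
    by rewrite /a !mulr_sumr; apply: eq_bigr => j _; rewrite xk mulr1; ring.
  rewrite mulr_sumr [RHS]big_mkcond/=.
  transitivity (\sum_x \sum_(j in T) W x * lambda j (occ x j) * p i
      * (agree T (z k) x)%:R); last first.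
    apply: eq_bigr => x _; case: ifP => zx; last by rewrite big1// => j _; rewrite mulr0.
    by rewrite !mulr_sumr; apply: eq_bigr => j _; rewrite mulr1; ring.
  rewrite [RHS]exchange_big/=; apply: eq_bigr => j jT.
  rewrite (sum_move_swap lambda0 detailed_balance i j (fun x _ => (agree T (z k.+1) x)%:R)).
  apply: eq_bigr => x _; have [->|xj] := posnP (occ x j).
    by rewrite lambda0 mulr0 !mul0r.
  have jS : j \in S by exact: (fintype.subsetP TS).
  have ij : (i == j) = false by apply: contraNF iT => /eqP ->.
  congr (_ * _%:R); rewrite -!levelE ?(ltnW kM)//.
  by rewrite -(agree_eqr _ (agree_move jS iS xj)) occ_move// eqxx ij subn0 addn1.
- by move=> k kM; rewrite -subr_ge0 (le_trans dpT)// a_step.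
- by move=> k kM; rewrite -subr_ge0 (le_trans (ltW pid))// b_step.
- by move=> k kM; have := a_step k kM; have := b_step k kM; rewrite sumS; lra.
Qed.

Definition pair_energy f i j :=
  \sum_x W x * lambda i (occ x i) * p j * D (f x) (f (move x i j)).
Definition energy S f := \sum_(i in S) \sum_(j in (S :\ i)%SET) pair_energy f i j.

Lemma pair_energy_ge0 f i j : (forall y, 0 < f y) -> 0 <= pair_energy f i j.
Proof.
move=> f0; apply: sumr_ge0 => x _; apply: mulr_ge0; last exact: D_ge0.
by rewrite mulr_ge0 ?(ltW (p_gt0 _))// mulr_ge0 ?lambda_ge0// ltW.
Qed.

Lemma energy_setD1 S f i : i \in S -> energy S f =
  \sum_(j in (S :\ i)%SET) pair_energy f i j
  + \sum_(j in (S :\ i)%SET) pair_energy f j i + energy (S :\ i)%SET f.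
Proof.
move=> iS; rewrite /energy (big_setD1 i)//= -addrA; congr (_ + _).
rewrite -big_split/=; apply: eq_bigr => j; rewrite !inE => /andP[ji jS].
rewrite (big_setD1 i)/=; last by rewrite !inE eq_sym ji.
by rewrite finset.setDDl finset.setUC -finset.setDDl.
Qed.

(** The birth and death estimate leaves the gradient of an average, weighted by p(S \ i). [D_avg_le]
    trades it for the gradient of f: the weight is absorbed and the price is Delta / delta. *)
Lemma site_entropy S i f : i \in S -> (0 < #|(S :\ i)%SET|)%N -> (forall y, 0 < f y) ->
  delta ^+ 2 * (\sum_(k in S) p k) *
    \sum_x W x * (Phi (avg (S :\ i) f x) - Phi (avg S f x))
  <= Delta * \sum_(j in (S :\ i)%SET) pair_energy f i j.
Proof.
move=> iS /card_gt0P[j0 j0T] f0; set T := (S :\ i)%SET in j0T *.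
have iT : i \notin T by rewrite !inE eqxx.
set pS := \sum_(k in S) p k.
pose rhs x := lambda i (occ x i) * (\sum_(k in T) p k) * D (avg T f x) (avg T f (move x i j0)).
have H : \sum_x W x * (delta * pS * (Phi (avg T f x) - Phi (avg S f x)))
    <= \sum_x W x * rhs x.
  by apply: (@ler_sum_class S) => x0; exact: site_entropy_class.
have -> : delta ^+ 2 * pS * \sum_x W x * (Phi (avg T f x) - Phi (avg S f x))
    = delta * \sum_x W x * (delta * pS * (Phi (avg T f x) - Phi (avg S f x))).
  by rewrite [RHS]mulr_sumr mulr_sumr; apply: eq_bigr => x _; ring.
apply: le_trans (ler_wpM2l (ltW delta_gt0) H) _.
pose psi y := \sum_(j in T) p j * D (f y) (f (move y i j)).
have -> : Delta * \sum_(j in T) pair_energy f i j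
    = \sum_x W x * avg T (fun y => Delta * psi y) x * lambda i (occ x i).
  rewrite (sum_avg (S := T) (fun y => Delta * psi y) (g := fun x => lambda i (occ x i))).
    rewrite exchange_big/= mulr_sumr; apply: eq_bigr => x _.
    rewrite /psi mulr_sumr !mulr_sumr mulr_suml; apply: eq_bigr => j _; ring.
  by move=> x y /agreeP/(_ i iT) ->.
rewrite mulr_sumr; apply: ler_sum => x _; rewrite avgZ.
have [xi|xi] := posnP (occ x i); first by rewrite /rhs xi lambda0 !mul0r !mulr0.
have := D_avg_le iT j0T xi f0; rewrite -/(psi) => H1.
have Wl : 0 <= W x * lambda i (occ x i) by rewrite mulr_ge0 ?lambda_ge0// ltW.
have := ler_wpM2l Wl H1; rewrite /rhs; congr (_ <= _); ring.
Qed.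

Lemma avg_card1 S f x : (#|S| <= 1)%N -> avg S f x = f x.
Proof.
move=> S1; apply: avg_id => y xy; congr f; apply/esym.
move: xy; apply: (move_invariant_agree (u := id)) => {x y} x i j iS jS xi.
have -> : j = i by move/card_le1P: S1 => /(_ i iS j); rewrite jS inE => /esym/eqP.
by apply: config_ext => k; rewrite occ_move// addnK.
Qed.

(** Summing [step] over i loses nothing. The weights p(S) - p i add up to (|S| - 1) p(S), and on the
    right the ordered pair (k, j) is missing only for i = j, so it is counted |S| - 1 times too. *)
Lemma subsystem_entropy S f : (forall y, 0 < f y) ->
  delta ^+ 2 * (\sum_(k in S) p k) * \sum_x W x * (Phi (f x) - Phi (avg S f x))
  <= Delta * energy S f.
Proof.
move=> f0; move sE : #|S| => s.
elim: s S sE => [|s IH] S sE.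
  rewrite [X in _ * X <= _]big1 => [|x _]; last by rewrite avg_card1 ?sE// subrr mulr0.
  by rewrite mulr0 /energy (cards0_eq sE) big_set0 mulr0.
have [s0|s0] := posnP s.
  rewrite [X in _ * X <= _]big1 => [|x _]; last by rewrite avg_card1 ?sE ?s0// subrr mulr0.
  have /cards1P[i ->] : #|S| == 1%N by rewrite sE s0.
  by rewrite mulr0 /energy big_set1 finset.setDv big_set0 mulr0.
have card_rem i : i \in S -> #|(S :\ i)%SET| = s.
  by move=> iS; move: sE; rewrite (cardsD1 i) iS add1n => -[].
set pS := \sum_(k in S) p k.
set Ent := \sum_x W x * (Phi (f x) - Phi (avg S f x)).
have pS0 : 0 < pS.
  have /card_gt0P[i iS] : (0 < #|S|)%N by rewrite sE.
  rewrite /pS (big_setD1 i)//= ltr_pwDl// sumr_ge0// => k _; exact: ltW.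
have step i : i \in S -> delta ^+ 2 * (pS - p i) * Ent
    <= Delta * (energy (S :\ i)%SET f + \sum_(j in (S :\ i)%SET) pair_energy f i j).
  move=> iS; have H1 := IH _ (card_rem i iS).
  have H2 := @site_entropy S i f iS; rewrite card_rem// in H2; have {}H2 := H2 s0 f0.
  have pT : \sum_(k in (S :\ i)%SET) p k = pS - p i.
    by rewrite /pS (big_setD1 i iS)/= addrC addrK.
  rewrite pT in H1; rewrite -/pS in H2.
  set V := \sum_(j in _) _ in H2 *.
  set E1 := \sum_x _ in H1; set E2 := \sum_x _ in H2.
  have -> : Ent = E1 + E2.
    by rewrite /E1 /E2 -big_split/=; apply: eq_bigr => x _; ring.
  have V0 : 0 <= Delta * V.
    by rewrite mulr_ge0// sumr_ge0// => j _; exact: pair_energy_ge0.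
  have pT0 : 0 <= pS - p i by rewrite -pT sumr_ge0// => k _; exact: ltW.
  (* Multiply the one-site bound by p(S \ i) / p(S), at most 1, to match the weight in the induction
     hypothesis. *)
  have H3 : delta ^+ 2 * (pS - p i) * E2 <= Delta * V.
    have r0 : 0 <= (pS - p i) / pS by rewrite divr_ge0// ltW.
    have r1 : (pS - p i) / pS <= 1 by rewrite ler_pdivrMr// mul1r gerBl ltW.
    have := ler_wpM2l r0 H2.
    have -> : (pS - p i) / pS * (delta ^+ 2 * pS * E2) = delta ^+ 2 * (pS - p i) * E2.
      by field; rewrite gt_eqF.
    by move=> /le_trans; apply; apply: ler_piMl.
  lra.
have : \sum_(i in S) (delta ^+ 2 * (pS - p i) * Ent) <= \sum_(i in S)
    (Delta * (energy (S :\ i)%SET f + \sum_(j in (S :\ i)%SET) pair_energy f i j)).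
  by apply: ler_sum.
rewrite -mulr_suml -!mulr_sumr sumrB sumr_const sE -/pS.
have -> : \sum_(i in S) (energy (S :\ i)%SET f + \sum_(j in (S :\ i)%SET) pair_energy f i j)
    = s%:R * energy S f.
  transitivity (\sum_(i in S) (energy S f - \sum_(j in (S :\ i)%SET) pair_energy f j i)).
    by apply: eq_bigr => i iS; rewrite (energy_setD1 f iS); ring.
  rewrite sumrB sumr_const sE.
  have -> : \sum_(i in S) \sum_(j in (S :\ i)%SET) pair_energy f j i = energy S f.
    rewrite /energy (exchange_big_dep (mem S))/=; last first.
      by move=> i j _; rewrite !inE => /andP[].
    apply: eq_bigr => j jS; apply: eq_bigl => i; rewrite !inE jS andbT eq_sym.
    by rewrite andbC.
  by rewrite mulrS addrAC subrr add0r mulr_natl.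
have sR : 0 < s%:R :> R by rewrite ltr0n.
have -> : delta ^+ 2 * (pS *+ s.+1 - pS) * Ent = s%:R * (delta ^+ 2 * pS * Ent).
  by rewrite mulrS addrAC subrr add0r -mulr_natl; ring.
by rewrite [leRHS]mulrCA ler_pM2l.
Qed.

End ZeroRangeDynamics.

(** * The zero-range measure *)

Section Weights.
Variables (R : realType) (n m : nat) (p : 'I_n -> R) (lambda : 'I_n -> nat -> R).
Hypothesis lambda_gt0 : forall i l, (0 < l <= m)%N -> 0 < lambda i l.
Implicit Types (x : config n m) (i j k : 'I_n).

Let site_weight i l : R := p i ^+ l / \prod_(1 <= k < l.+1) lambda i k.

Let site_weightS i l : (l < m)%N ->
  site_weight i l.+1 * lambda i l.+1 = site_weight i l * p i.
Proof.
move=> lm; rewrite /site_weight big_nat_recr//= exprSr invfM.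
have : lambda i l.+1 != 0 by rewrite gt_eqF// lambda_gt0.
by move: (_ ^-1) => /= P l0; field.
Qed.

Lemma zr_weight_balance x i j : (0 < occ x i)%N ->
  zr_weight p lambda x * lambda i (occ x i) * p j
  = zr_weight p lambda (move x i j) * lambda j (occ (move x i j) j) * p i.
Proof.
move=> xi; have E := occ_move (i := i) j xi.
have [ij|ij] := eqVneq i j.
  have -> : move x i j = x by apply: config_ext => k; rewrite E -ij addnK.
  by rewrite ij.
rewrite /zr_weight -!/(site_weight _ _) (bigD1 i)//= (bigD1 j) 1?eq_sym//=.
rewrite [in RHS](bigD1 i)//= [in RHS](bigD1 j) 1?eq_sym//= -!/(site_weight _ _).
rewrite [in RHS](eq_bigr (fun k => site_weight k (occ x k))); last first.
  by move=> k /andP[ki kj]; rewrite E (negbTE ki) (negbTE kj) addn0 subn0.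
under eq_bigr do rewrite -/(site_weight _ _).
have ji : (j == i) = false by rewrite eq_sym (negbTE ij).
rewrite !E !eqxx (negbTE ij) ji subn0 addn0 addn1.
have xj : (occ x j < m)%N := occ_lt ij xi.
have H1 := site_weightS j xj.
have xi1 : ((occ x i).-1 < m)%N by rewrite prednK// occ_le.
have := site_weightS i xi1; rewrite prednK// -subn1 => H2.
move: (\prod_(k | _) _) => Q.
set a := site_weight j (occ x j).+1 in H1 *; set b := lambda j _ in H1 *.
set c := site_weight i (occ x i) in H2 *; set d := lambda i _ in H2 *.
set e := site_weight i _ in H2 *; set g := site_weight j _ in H1 *.
transitivity ((c * d) * (g * p j) * Q); first by ring.
by rewrite H2 -H1; ring.
Qed.

Hypothesis p_ge0 : forall i, 0 <= p i.

Lemma zr_weight_ge0 x : 0 <= zr_weight p lambda x.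
Proof.
apply: prodr_ge0 => i _; apply: divr_ge0; first exact: exprn_ge0.
rewrite big_nat_cond; apply: prodr_ge0 => l /andP[/andP[l0 lx] _]; apply/ltW/lambda_gt0.
by rewrite l0 (leq_trans _ (occ_le x i)).
Qed.

Lemma zr_weight_gt0 x : (forall i, (0 < occ x i)%N -> 0 < p i) -> 0 < zr_weight p lambda x.
Proof.
move=> px; apply: prodr_gt0 => i _; apply: divr_gt0.
  have [->|/px] := posnP (occ x i); first by rewrite expr0.
  exact: exprn_gt0.
rewrite big_nat_cond; apply: prodr_gt0 => l /andP[/andP[l0 lx] _]; apply: lambda_gt0.
by rewrite l0 (leq_trans _ (occ_le x i)).
Qed.

Hypothesis p_sum1 : \sum_i p i = 1.

Lemma exists_pos_site : exists j, 0 < p j.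
Proof.
apply/not_existsP => H; have : \sum_i p i = 0.
  apply: big1 => i _; apply/eqP; move: (H i) => /negP; rewrite -leNgt => pi.
  by rewrite eq_le pi p_ge0.
by rewrite p_sum1 => /eqP; rewrite oner_eq0.
Qed.

Lemma exists_concentrated j : exists x, forall k, occ x k = if k == j then m else 0%N.
Proof.
pose f : {ffun 'I_n -> 'I_m.+1} := [ffun k => if k == j then ord_max else ord0].
have fE k : f k = (if k == j then m else 0%N) :> nat by rewrite ffunE; case: ifP.
have fP : (\sum_i (f i : nat) == m)%N.
  by rewrite (bigD1 j)//= fE eqxx big1 ?addn0// => k /negbTE kj; rewrite fE kj.
by exists (Config fP) => k; exact: fE.
Qed.

(** Some p i may vanish, so a positive weight is exhibited: all m particles at a site with p j >
    0. *)
Lemma zr_Z_gt0 : 0 < @zr_Z R n m p lambda.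
Proof.
have [j pj] := exists_pos_site; have [x xE] := exists_concentrated j.
rewrite /zr_Z (bigD1 x)//= ltr_pwDl//; last first.
  by apply: sumr_ge0 => y _; exact: zr_weight_ge0.
by apply: zr_weight_gt0 => i; rewrite xE; case: eqP => [->|].
Qed.

Lemma zr_mu_ge0 x : 0 <= zr_mu p lambda x.
Proof. by rewrite mulr_ge0 ?zr_weight_ge0// invr_ge0 ltW// zr_Z_gt0. Qed.

Lemma zr_mu_sum1 : \sum_(x : config n m) zr_mu p lambda x = 1.
Proof. by rewrite -mulr_sumr mulVf// gt_eqF// zr_Z_gt0. Qed.

Lemma zr_mu_balance x i j : (0 < occ x i)%N ->
  zr_mu p lambda x * lambda i (occ x i) * p j
  = zr_mu p lambda (move x i j) * lambda j (occ (move x i j) j) * p i.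
Proof.
by move=> xi; rewrite /zr_mu -!mulrA; congr (_ * _); rewrite !mulrA zr_weight_balance.
Qed.

Hypothesis lambda0 : forall i, lambda i 0%N = 0.

Let sum_setT (F : 'I_n -> R) : \sum_(i in [set: 'I_n]%SET) F i = \sum_i F i.
Proof. by apply: eq_bigl => i; rewrite inE. Qed.

Lemma zr_genE (f : config n m -> R) x :
  zr_gen p lambda f x = subsystem_gen p lambda [set: 'I_n]%SET f x.
Proof.
rewrite /subsystem_gen sum_setT; apply: eq_bigr => i _.
by rewrite sum_setT; apply: eq_bigr => j _; ring.
Qed.

Lemma zr_reversibleP : @zr_reversible R n m p lambda.
Proof.
move=> f g; rewrite /zr_mean.
have := gen_sym lambda0 zr_mu_balance [set: 'I_n]%SET f g.
under eq_bigr do rewrite -mulrA -zr_genE.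
under [X in _ = X -> _]eq_bigr do rewrite -mulrA -zr_genE.
by move=> ->; apply: eq_bigr => x _; ring.
Qed.

Lemma zr_dirichletE (f g : config n m -> R) : zr_dirichlet p lambda f g
  = 2^-1 * \sum_x \sum_i \sum_j zr_mu p lambda x * lambda i (occ x i) * p j
    * ((f (move x i j) - f x) * (g (move x i j) - g x)).
Proof.
rewrite /zr_dirichlet /zr_mean.
have := gen_energy lambda0 zr_mu_balance [set: 'I_n]%SET f g.
under eq_bigr do rewrite -mulrA -zr_genE.
move=> ->; rewrite mulNr opprK; congr (_ * _); apply: eq_bigr => x _.
by rewrite sum_setT; apply: eq_bigr => i _; rewrite sum_setT.
Qed.

End Weights.

(** * The Beckner inequality *)

Lemma cvg_big_sum (R : realType) (I : Type) (r : seq I) (F : I -> R -> R) (l : I -> R)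
    (G : set_system R) : Filter G ->
  (forall i, F i @ G --> l i)%classic ->
  ((fun t => \sum_(i <- r) F i t) @ G --> \sum_(i <- r) l i)%classic.
Proof.
move=> FG H; elim: r => [|i r IH].
  by under eq_fun do rewrite big_nil; rewrite big_nil; exact: cvg_cst.
by under eq_fun do rewrite big_cons; rewrite big_cons; exact: cvgD.
Qed.

Lemma cvg_addl_right (R : realType) (c : R) :
  ((fun t => c + t) @ 0^'+ --> c)%classic.
Proof.
rewrite -[X in (_ --> X)%classic](addr0 c); apply: cvgD; first exact: cvg_cst.
by apply: cvg_at_right_filter; exact: cvg_id.
Qed.

(** At c = 0 the power need not be differentiable, so that case is separate and only the right limit
    is taken. *)
Lemma cvg_powR_addl_right (R : realType) (c s : R) : 0 <= c -> 0 < s ->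
  ((fun t => (c + t) `^ s) @ 0^'+ --> c `^ s)%classic.
Proof.
move=> c0 s0; have [->|cn0] := eqVneq c 0.
  rewrite powR0 ?gt_eqF//; under eq_fun do rewrite add0r; exact: powR_cvg0.
have cp : 0 < c by rewrite lt_def cn0.
have cp' : 0 < c + 0 * 1 by rewrite mul0r addr0.
have [/derivable1_diffP/differentiable_continuous H _] := @is_derive_powR_line R c 1 s 0 cp'.
have := cvg_at_right_filter H; rewrite mul0r addr0.
by under eq_fun do rewrite mulr1.
Qed.

Section Beckner.
Variables (R : realType) (n m : nat) (p : 'I_n -> R).
Variables (lambda : 'I_n -> nat -> R) (delta Delta : R).
Hypothesis p_ge0 : forall i, 0 <= p i.
Hypothesis p_sum1 : \sum_i p i = 1.
Hypothesis delta_gt0 : 0 < delta.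
Hypothesis Delta_gt0 : 0 < Delta.
Hypothesis lambda0 : forall i, lambda i 0%N = 0.
Hypothesis lambda_incr : forall i l, (l < m)%N ->
  delta <= lambda i l.+1 - lambda i l <= Delta.
Implicit Types (x : config n m) (f : config n m -> R).

Let lambda_pos := @lambda_gt0 R n m lambda delta Delta delta_gt0 lambda0 lambda_incr.
Local Notation mean := (zr_mean p lambda).
Local Notation mu := (zr_mu p lambda).

Lemma zr_phi_entropy (Phi dPhi : R -> R) f :
  (forall a b, 0 < a -> 0 < b -> Phi a + dPhi a * (b - a) <= Phi b) ->
  (forall c d, 0 < c -> 0 < d -> exists e1 e2, forall a b, 0 < a -> 0 < b ->
    sym_bregman dPhi c d + e1 * (a - c) + e2 * (b - d) <= sym_bregman dPhi a b) ->
  (forall x, 0 < f x) ->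
  delta ^+ 2 * (mean (fun x => Phi (f x)) - Phi (mean f))
  <= 2 * Delta * zr_dirichlet p lambda f (fun x => dPhi (f x)).
Proof.
move=> Phi_tangent D_tangent f0.
(* Sites with p i = 0 stay empty mu-almost surely; giving them weight 1 makes
   all the weights positive, and mu is the weight conditioned on the class of
   configurations with no particle on these sites. *)
pose S := [set i | 0 < p i]%SET; pose p' i := if 0 < p i then p i else 1.
have p'0 i : 0 < p' i by rewrite /p'; case: ifP.
have p'S i : i \in S -> p' i = p i by rewrite inE /p' => ->.
have pS i : i \notin S -> p i = 0.
  by rewrite inE -leNgt => pi; apply/eqP; rewrite eq_le pi p_ge0.
pose W : config n m -> R := zr_weight p' lambda.
have W0 x : 0 < W x by apply: zr_weight_gt0.
have [j0 pj0] := exists_pos_site p_ge0 p_sum1.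
have [x1 x1E] := @exists_concentrated n m j0.
pose A x := agree S x1 x.
have AP x : reflect (forall k, k \notin S -> occ x k = 0%N) (A x).
  have x1S k : k \notin S -> occ x1 k = 0%N.
    by rewrite x1E; case: eqP => // ->; rewrite inE pj0.
  by apply: (iffP (agreeP _ _ _)) => H k kS; rewrite ?x1S ?H // -H ?x1S.
have wE x : zr_weight p lambda x = if A x then W x else 0.
  case: ifPn => [/AP Ax|/AP Ax].
    apply: eq_bigr => i _; case: (boolP (i \in S)) => iS; first by rewrite p'S.
    by rewrite Ax// !expr0.
  have [k [kS xk]] : exists k, k \notin S /\ (0 < occ x k)%N.
    apply/not_existsP => H; apply: Ax => k kS; apply/eqP; rewrite eqn0Ngt.
    by apply/negP => xk; apply: (H k).
  by rewrite /zr_weight (bigD1 k)//= pS// expr0n gtn_eqF//= !mul0r.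
set Z := class_mass W S x1.
have Z0 : 0 < Z by exact: class_mass_gt0.
have ZE : @zr_Z R n m p lambda = Z.
  by rewrite /Z /class_mass [RHS]big_mkcond; apply: eq_bigr => x _; exact: wE.
have meanE f' : mean f' = avg W S f' x1.
  rewrite /mean /zr_mean /avg mulrC mulr_sumr [RHS]big_mkcond/=.
  apply: eq_bigr => x _; rewrite /zr_mu ZE wE /A -/Z.
  by case: ifP => _; rewrite -mulrA ?mul0r ?mulr0.
(* Off [A] the function is constant, so it contributes neither entropy nor energy there. *)
pose f' x := if A x then f x else 1.
have f'0 x : 0 < f' x by rewrite /f'; case: ifP.
have := subsystem_entropy p'0 delta_gt0 (ltW Delta_gt0) lambda0 lambda_incr W0
  (zr_weight_balance p' lambda_pos) Phi_tangent D_tangent S f'0.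
have -> : \sum_(k in S) p' k = 1.
  rewrite -p_sum1 [RHS](bigID (mem S))/= [X in _ = _ + X]big1 ?addr0//.
  by apply: eq_bigr => i; exact: p'S.
rewrite mulr1.
have A_avg x : ~~ A x -> avg W S f' x = 1.
  move=> Ax; have f'1 y : agree S x y -> f' y = 1.
    by move=> xy; rewrite /f' /A -(agree_eqr _ xy) -/(A x) (negbTE Ax).
  by rewrite (avg_id W0) ?f'1 ?agree_refl// => y xy; rewrite !f'1 ?agree_refl.
have A_avg1 x : A x -> avg W S f' x = mean f.
  move=> Ax; rewrite meanE -(avg_eq W f' Ax); apply: eq_avg => y Hy.
  by rewrite /f' /A Hy.
have -> : \sum_x W x * (Phi (f' x) - Phi (avg W S f' x))
    = Z * (mean (fun x => Phi (f x)) - Phi (mean f)).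
  have ZmeanE : Z * mean (fun x => Phi (f x)) = \sum_(x | agree S x1 x) W x * Phi (f x).
    by rewrite meanE /avg mulrC divfK// gt_eqF.
  rewrite mulrBr ZmeanE {1}/Z /class_mass mulr_suml -sumrB.
  rewrite [RHS]big_mkcond/=; apply: eq_bigr => x _; rewrite -/(A x).
  case: ifPn => Ax; last by rewrite A_avg// /f' (negbTE Ax) subrr mulr0.
  by rewrite A_avg1// /f' Ax mulrBr.
(* [energy] runs over ordered pairs without the factor 1/2 of the Dirichlet form, hence the 2. *)
have : energy p' lambda W dPhi S f' <= Z * (2 * zr_dirichlet p lambda f (fun x => dPhi (f x))).
  have -> : Z * (2 * zr_dirichlet p lambda f (fun x => dPhi (f x))) =
      \sum_i \sum_j \sum_x zr_weight p lambda x * lambda i (occ x i) * p j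
      * sym_bregman dPhi (f x) (f (move x i j)).
    rewrite zr_dirichletE// mulVKf ?pnatr_eq0//.
    under [RHS]eq_bigr do rewrite exchange_big/=.
    rewrite [RHS]exchange_big/= mulr_sumr; apply: eq_bigr => x _.
    rewrite mulr_sumr; apply: eq_bigr => i _; rewrite mulr_sumr; apply: eq_bigr => j _.
    rewrite /zr_mu ZE /sym_bregman; field; rewrite gt_eqF//.
  have w_ge0 x i j : 0 <= zr_weight p lambda x * lambda i (occ x i) * p j
      * sym_bregman dPhi (f x) (f (move x i j)).
    apply: mulr_ge0; last exact: (sym_bregman_ge0 Phi_tangent).
    rewrite mulr_ge0// mulr_ge0 ?zr_weight_ge0//.
    exact: (lambda_ge0 delta_gt0 lambda0 lambda_incr).
  rewrite /energy [leLHS]big_mkcond/=; apply: ler_sum => i _.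
  case: ifPn => iS; last by rewrite sumr_ge0// => j _; rewrite sumr_ge0.
  rewrite [leLHS]big_mkcond/=; apply: ler_sum => j _.
  case: ifPn => [|_]; last by rewrite sumr_ge0.
  rewrite !inE => /andP[_ pj]; have jS : j \in S by rewrite inE.
  apply: ler_sum => x _; rewrite wE p'S//.
  have [->|xi] := posnP (occ x i); first by rewrite lambda0 !mulr0 !mul0r.
  have AM : A (move x i j) = A x.
    by rewrite /A -(agree_eqr _ (agree_move iS jS xi)).
  rewrite /f' AM; case: ifP => _; first exact: lexx.
  by rewrite /sym_bregman subrr !mul0r mulr0.
move=> H1 H2; rewrite -(ler_pM2l Z0).
have := le_trans H2 (ler_wpM2l (ltW Delta_gt0) H1).
by congr (_ <= _); ring.
Qed.

Lemma beckner_pos f q : 1 < q <= 2 -> (forall x, 0 < f x) ->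
  delta ^+ 2 / (12 * Delta) * (mean (fun x => f x `^ q) - mean f `^ q)
  <= q / 2 * zr_dirichlet p lambda f (fun x => f x `^ (q - 1)).
Proof.
move=> /andP[q1 q2] f0.
have q0 : 0 < q by exact: lt_trans q1.
have s01 : 0 < q - 1 <= 1 by apply/andP; split; lra.
have := @zr_phi_entropy (fun t => t `^ q) (fun t => q * t `^ (q - 1)) f.
have T1 (a b : R) : 0 < a -> 0 < b ->
    a `^ q + q * a `^ (q - 1) * (b - a) <= b `^ q.
  by move=> a0 b0; apply: powR_tangent => //; exact: ltW.
have T2 (c d : R) : 0 < c -> 0 < d -> exists e1 e2, forall a b, 0 < a -> 0 < b ->
    sym_bregman (fun t => q * t `^ (q - 1)) c d + e1 * (a - c) + e2 * (b - d)
    <= sym_bregman (fun t => q * t `^ (q - 1)) a b.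
  move=> c0 d0; have [e1 [e2 H]] := sym_bregman_powR_tangent s01 c0 d0.
  exists (q * e1), (q * e2) => a b a0 b0.
  by have := ler_wpM2l (ltW q0) (H a b a0 b0); rewrite /sym_bregman; lra.
move=> /(_ T1 T2 f0).
have : 0 <= zr_dirichlet p lambda f (fun x => q * f x `^ (q - 1)).
  rewrite zr_dirichletE// mulr_ge0//; apply: sumr_ge0 => x _.
  apply: sumr_ge0 => i _; apply: sumr_ge0 => j _; rewrite mulr_ge0//.
    rewrite mulr_ge0// mulr_ge0 ?zr_mu_ge0//.
    exact: (lambda_ge0 delta_gt0 lambda0 lambda_incr).
  by have := sym_bregman_ge0 T1 (f0 (move x i j)) (f0 x).
have -> : zr_dirichlet p lambda f (fun x => q * f x `^ (q - 1))
    = q * zr_dirichlet p lambda f (fun x => f x `^ (q - 1)).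
  rewrite !zr_dirichletE// mulrCA; congr (_ * _).
  rewrite mulr_sumr; apply: eq_bigr => x _; rewrite mulr_sumr; apply: eq_bigr => i _.
  by rewrite mulr_sumr; apply: eq_bigr => j _; ring.
set Ent := _ - _; set E := zr_dirichlet _ _ _ _ => E0 H.
have D12 : 0 < 12 * Delta by rewrite mulr_gt0.
rewrite mulrAC ler_pdivrMr//; apply: le_trans H _.
have := mulr_ge0 (ltW Delta_gt0) E0; lra.
Qed.

(** Apply [beckner_pos] to f + t and let t decrease to 0; both sides are continuous there because q
    - 1 > 0. *)
Lemma beckner f q : 1 < q <= 2 -> (forall x, 0 <= f x) ->
  delta ^+ 2 / (12 * Delta) * (mean (fun x => f x `^ q) - mean f `^ q)
  <= q / 2 * zr_dirichlet p lambda f (fun x => f x `^ (q - 1)).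
Proof.
move=> q12 f0; have /andP[q1 _] := q12.
have q0 : 0 < q by exact: lt_trans q1.
have s0 : 0 < q - 1 by rewrite subr_gt0.
pose G t := q / 2 * zr_dirichlet p lambda (fun x => f x + t) (fun x => (f x + t) `^ (q - 1))
  - delta ^+ 2 / (12 * Delta) * (mean (fun x => (f x + t) `^ q)
      - (mean f + t) `^ q).
rewrite -subr_ge0.
apply: (@cvgr_to_ge _ (0^'+)%classic _ _ G); last first.
  near=> t; have t0 : 0 < t by near: t; exact: nbhs_right_gt.
  rewrite /G; have -> : mean f + t = mean (fun x => f x + t).
    rewrite /zr_mean; under [RHS]eq_bigr do rewrite mulrDr.
    by rewrite big_split/= -mulr_suml zr_mu_sum1// mul1r.
  rewrite subr_ge0; apply: beckner_pos => // x; exact: ltr_wpDl.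
rewrite zr_dirichletE// /G; under eq_fun do rewrite zr_dirichletE//.
have mean_ge0 : 0 <= mean f.
  by apply: sumr_ge0 => x _; rewrite mulr_ge0// zr_mu_ge0.
apply: cvgB; (apply: cvgM; first exact: cvg_cst); last first.
  apply: cvgB; last exact: cvg_powR_addl_right.
  apply: cvg_big_sum => x; apply: cvgM; first exact: cvg_cst.
  exact: cvg_powR_addl_right.
apply: cvgM; first exact: cvg_cst.
apply: cvg_big_sum => x; apply: cvg_big_sum => i; apply: cvg_big_sum => j.
apply: cvgM; first exact: cvg_cst.
apply: cvgM; apply: cvgB.
- exact: cvg_addl_right.
- exact: cvg_addl_right.
- exact: cvg_powR_addl_right.
- exact: cvg_powR_addl_right.
Unshelve. all: by end_near. Qed.

End Beckner.

(** * Moment estimates *)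

Section FiniteMoments.
Variables (R : realType) (T : finType) (mu : T -> R).
Hypothesis mu_ge0 : forall x, 0 <= mu x.
Hypothesis mu_sum1 : \sum_x mu x = 1.
Implicit Types u v g : T -> R.

Lemma finite_hoelder u v (t : R) : 0 < t < 1 ->
  (forall x, 0 <= u x) -> (forall x, 0 <= v x) ->
  \sum_x mu x * (u x `^ (1 - t) * v x `^ t)
  <= (\sum_x mu x * u x) `^ (1 - t) * (\sum_x mu x * v x) `^ t.
Proof.
move=> /andP[t0 t1] u0 v0; have t1' : 0 < 1 - t by rewrite subr_gt0.
have zero w : (forall x, 0 <= w x) -> \sum_x mu x * w x = 0 -> forall x, mu x * w x = 0.
  by move=> w0 /psumr_eq0P H x; apply: H => // y _; rewrite mulr_ge0.
have [U0|U0] := eqVneq (\sum_x mu x * u x) 0.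
  rewrite U0 powR0 ?gt_eqF// mul0r big1// => x _.
  have /eqP := zero _ u0 U0 x; rewrite mulf_eq0 => /orP[]/eqP ->; first by rewrite mul0r.
  by rewrite powR0 ?gt_eqF// mul0r mulr0.
have [V0|V0] := eqVneq (\sum_x mu x * v x) 0.
  rewrite V0 [X in _ * X]powR0 ?gt_eqF// mulr0 big1// => x _.
  have /eqP := zero _ v0 V0 x; rewrite mulf_eq0 => /orP[]/eqP ->; first by rewrite mul0r.
  by rewrite [X in _ * (_ * X)]powR0 ?gt_eqF// !mulr0.
set U := \sum_x mu x * u x in U0 *; set V := \sum_x mu x * v x in V0 *.
have Up : 0 < U by rewrite lt_def U0 sumr_ge0// => x _; rewrite mulr_ge0.
have Vp : 0 < V by rewrite lt_def V0 sumr_ge0// => x _; rewrite mulr_ge0.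
have C0 : 0 < U `^ (1 - t) * V `^ t by rewrite mulr_gt0// powR_gt0.
rewrite -[leRHS]mulr1 -ler_pdivrMl// mulr_sumr.
apply: (@le_trans _ _ (\sum_x ((1 - t) / U * (mu x * u x) + t / V * (mu x * v x)))).
  apply: ler_sum => x _.
  have := @weighted_AMGM R (u x / U) (v x / V) t.
  rewrite !divr_ge0 ?(ltW Up) ?(ltW Vp)// (ltW t0) (ltW t1) => /(_ isT isT isT).
  have invE (w : R) (s : R) : 0 < w -> w^-1 `^ s = (w `^ s)^-1.
    by move=> w0; rewrite -(powR_inv1 (ltW w0)) -powRrM mulN1r powRN.
  rewrite !powRM ?invr_ge0 ?(ltW Up) ?(ltW Vp)// !invE// => H.
  have := ler_wpM2l (mu_ge0 x) H; rewrite invfM; congr (_ <= _); ring.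
rewrite big_split -!mulr_sumr/= -/U -/V !divfK//; lra.
Qed.

Lemma moment_le g (a b : R) : 0 < a -> a <= b -> (forall x, 0 <= g x) ->
  (\sum_x mu x * g x `^ a) `^ a^-1 <= (\sum_x mu x * g x `^ b) `^ b^-1.
Proof.
move=> a0; rewrite le_eqVlt => /predU1P[<-//|ab] g0.
have b0 : 0 < b by exact: lt_trans ab.
have tb : 0 < a / b < 1 by rewrite divr_gt0//= ltr_pdivrMr// mul1r.
have := @finite_hoelder (fun=> 1) (fun x => g x `^ b) (a / b) tb (fun=> ler01)
  (fun x => powR_ge0 _ _).
under eq_bigr do rewrite powR1 mul1r -powRrM mulrCA mulfV ?gt_eqF// mulr1.
under [X in _ <= X `^ _ * _]eq_bigr do rewrite mulr1.
rewrite mu_sum1 powR1 mul1r => H.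
have a0' : 0 <= a^-1 by rewrite invr_ge0 ltW.
have powE (z : R) : (z `^ (a / b)) `^ a^-1 = z `^ b^-1.
  by rewrite -powRrM mulrAC mulfV ?gt_eqF// mul1r.
have := ge0_ler_powR a0' _ _ H; rewrite powE; apply.
  by rewrite nnegrE sumr_ge0// => x _; rewrite mulr_ge0// powR_ge0.
by rewrite nnegrE powR_ge0.
Qed.

End FiniteMoments.

(** The tangent at the larger endpoint bounds the increment of the t-th power, and only at that
    endpoint is the increment towards the other one negative. Both terms appear on the right so that
    the bound is symmetric. *)
Lemma pospart_increment (R : realType) (a b t : R) : 1 <= t ->
  (Num.max b 0 - Num.max a 0) * (Num.max b 0 `^ t - Num.max a 0 `^ t)
  <= t * Num.max a 0 `^ (t - 1) * Num.max (- (b - a)) 0 ^+ 2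
     + t * Num.max b 0 `^ (t - 1) * Num.max (- (a - b)) 0 ^+ 2.
Proof.
move=> t1; have t0 : 0 <= t by exact: le_trans t1.
wlog ab : a b / b <= a => [H|].
  case: (leP b a) => [/H//|/ltW/H{}H].
  by rewrite [leRHS]addrC -mulrNN !(opprB (Num.max b 0)) !(opprB (_ `^ _)).
set A := Num.max a 0; set B := Num.max b 0.
have B0 : 0 <= B by rewrite le_max lexx orbT.
have BA : B <= A by rewrite /A /B ge_max !le_max lexx ab orbT.
have r0 : 0 <= t * B `^ (t - 1) * Num.max (- (a - b)) 0 ^+ 2.
  by rewrite mulr_ge0 ?sqr_ge0// mulr_ge0// powR_ge0.
apply: (@le_trans _ _ (t * A `^ (t - 1) * Num.max (- (b - a)) 0 ^+ 2)); last first.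
  by rewrite lerDl.
have [A0|A0] := leP A 0.
  have -> : B = A by apply/eqP; rewrite eq_le BA (le_trans A0 B0).
  by rewrite subrr mul0r mulr_ge0 ?sqr_ge0// mulr_ge0// powR_ge0.
have aA : A = a by move: A0; rewrite /A; case: (leP a 0); rewrite ?ltxx.
have HT := powR_tangent t1 A0 B0.
have c0 : 0 <= t * A `^ (t - 1) by rewrite mulr_ge0// powR_ge0.
have -> : Num.max (- (b - a)) 0 = a - b.
  by rewrite opprB; apply/max_idPl; rewrite subr_ge0.
have AB : A - B <= a - b by rewrite aA lerD2l lerN2 le_max lexx.
apply: (@le_trans _ _ (t * A `^ (t - 1) * (A - B) ^+ 2)); last first.
  by rewrite ler_wpM2l// ler_sqr ?nnegrE ?subr_ge0.
have AB0 : 0 <= A - B by rewrite subr_ge0.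
have : 0 <= (A - B) * (B `^ t - (A `^ t + t * A `^ (t - 1) * (B - A))).
  by rewrite mulr_ge0// subr_ge0.
by move: (A `^ t) (B `^ t) (A `^ (t - 1)) => X Y Z; lra.
Qed.

(** Here y and z stand for the squared s-th and (s-1)-th norms. If y > kappa s B, then z <= (1 -
    1/s) y <= e^(-1/s) y, so z^(s/2) <= w y^(s/2); the recursion then gives (1 - w) y <= (s/2) B,
    which is y <= kappa s B. *)
Lemma moment_self_bound (R : realType) (z y B s : R) :
  2 <= s -> 0 <= y -> 0 <= z -> 0 <= B ->
  let kappa := (2 * (1 - expR (- 2^-1)))^-1 in
  z <= kappa * (s - 1) * B ->
  y `^ (s / 2) <= z `^ (s / 2) + s / 2 * (y `^ (s / 2 - 1) * B) ->
  y <= kappa * s * B.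
Proof.
move=> s2 y0 z0 B0; set w := expR (- 2^-1) => kappa z_le rec.
have s0 : 0 < s by lra.
have w1 : 0 < 1 - w by rewrite subr_gt0 expR_lt1 oppr_lt0.
have kappa0 : 0 <= kappa by rewrite invr_ge0 mulr_ge0// ltW.
rewrite leNgt; apply/negP => big.
have yp : 0 < y.
  apply: le_lt_trans big; apply: mulr_ge0 (B0); apply: mulr_ge0 => //; exact: ltW.
have low : z `^ (s / 2) <= w * y `^ (s / 2).
  have -> : w = expR (- s^-1) `^ (s / 2).
    by rewrite -expRM /w; congr expR; field; rewrite gt_eqF.
  have e0 := expR_ge0 (- s^-1).
  rewrite -powRM//; apply: ge0_ler_powR.
  - by rewrite divr_ge0// ltW.
  - by rewrite nnegrE.
  - by rewrite nnegrE mulr_ge0.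
  apply: le_trans z_le _.
  have -> : kappa * (s - 1) * B = (1 - s^-1) * (kappa * s * B) by field; rewrite gt_eqF.
  apply: ler_pM.
  - by rewrite subr_ge0 invf_le1//; lra.
  - by apply: mulr_ge0 (B0); apply: mulr_ge0 => //; exact: ltW.
  - exact: expR_ge1Dx.
  - exact: ltW.
have P0 : 0 < y `^ (s / 2 - 1) by rewrite powR_gt0.
have yE : y `^ (s / 2) = y * y `^ (s / 2 - 1).
  by rewrite mulr_powRB1 ?divr_gt0.
have : y `^ (s / 2 - 1) * (y * (1 - w)) <= y `^ (s / 2 - 1) * (s / 2 * B).
  by move: rec low; rewrite yE; lra.
rewrite ler_pM2l// => H.
move: big; apply/negP; rewrite -leNgt.
have -> : kappa * s * B = (s / 2 * B) / (1 - w).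
  by rewrite /kappa; field; rewrite gt_eqF.
by rewrite ler_pdivlMr.
Qed.

Section Moments.
Variables (R : realType) (n m : nat) (p : 'I_n -> R) (lambda : 'I_n -> nat -> R).
Variable alpha : R.
Hypothesis p_ge0 : forall i, 0 <= p i.
Hypothesis p_sum1 : \sum_i p i = 1.
Hypothesis lambda0 : forall i, lambda i 0%N = 0.
Hypothesis lambda_pos : forall i l, (0 < l <= m)%N -> 0 < lambda i l.
Hypothesis alpha_gt0 : 0 < alpha.
Local Notation mean := (zr_mean p lambda).
Local Notation mu := (zr_mu p lambda).
Hypothesis beckner_ineq : forall (f : config n m -> R) q, 1 < q <= 2 ->
  (forall x, 0 <= f x) ->
  alpha * (mean (fun x => f x `^ q) - mean f `^ q)
  <= q / 2 * zr_dirichlet p lambda f (fun x => f x `^ (q - 1)).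
Implicit Types (x y : config n m) (f : config n m -> R).

Let mu0 x : 0 <= mu x. Proof. exact: zr_mu_ge0. Qed.
Let mu1 : \sum_(x : config n m) mu x = 1. Proof. exact: zr_mu_sum1. Qed.

Let rate_ge0 x i j : 0 <= lambda i (occ x i) * p j.
Proof.
rewrite mulr_ge0//; have [->|xi] := posnP (occ x i); first by rewrite lambda0.
by rewrite ltW// lambda_pos// xi occ_le.
Qed.

Definition neg_gradient f x := \sum_(i < n) \sum_(j < n)
  Num.max (- (f (move x i j) - f x)) 0 ^+ 2 * lambda i (occ x i) * p j.

Lemma neg_gradient_ge0 f x : 0 <= neg_gradient f x.
Proof.
apply: sumr_ge0 => i _; apply: sumr_ge0 => j _.
by rewrite -mulrA mulr_ge0// sqr_ge0.
Qed.

(** Reversibility exchanges x and y in the second term, so the two terms have equal sums and cancel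
    the factor 1/2. *)
Lemma zr_dirichlet_le f g (c : config n m -> R) h :
  (forall x y, (f y - f x) * (g y - g x)
     <= c x * Num.max (- (h y - h x)) 0 ^+ 2 + c y * Num.max (- (h x - h y)) 0 ^+ 2) ->
  zr_dirichlet p lambda f g <= mean (fun x => c x * neg_gradient h x).
Proof.
move=> H; rewrite zr_dirichletE//.
pose w x y := c x * Num.max (- (h y - h x)) 0 ^+ 2.
pose Q := \sum_i \sum_j \sum_x mu x * lambda i (occ x i) * p j * w x (move x i j).
have -> : mean (fun x => c x * neg_gradient h x) = 2^-1 * (Q + Q).
  have -> : 2^-1 * (Q + Q) = Q by field.
  rewrite /Q; under eq_bigr do rewrite exchange_big/=.
  rewrite exchange_big/=; apply: eq_bigr => x _.
  rewrite /neg_gradient !mulr_sumr; apply: eq_bigr => i _.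
  by rewrite !mulr_sumr; apply: eq_bigr => j _; rewrite /w; ring.
rewrite ler_pM2l//.
have {2}-> : Q = \sum_i \sum_j \sum_x mu x * lambda i (occ x i) * p j * w (move x i j) x.
  rewrite /Q exchange_big/=; apply: eq_bigr => i _; apply: eq_bigr => j _.
  exact: (sum_move_swap lambda0 (zr_mu_balance p lambda_pos)).
rewrite exchange_big/= -big_split/=; apply: ler_sum => i _.
rewrite exchange_big/= -big_split/=; apply: ler_sum => j _.
rewrite -big_split/=; apply: ler_sum => x _; rewrite -mulrDr.
by apply: ler_wpM2l; rewrite ?H// -mulrA mulr_ge0.
Qed.

(** For q = r / (r - 1) the Dirichlet form is that of Y^(r-1) and Y, as in [pospart_increment] with
    t = r - 1; the factors combine to (q/2)(r - 1) = r/2. The condition q <= 2 is r >= 2. *)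
Lemma moment_recursion f (Y : config n m -> R) r : 2 <= r ->
  (forall x, Y x = Num.max (f x - mean f) 0) ->
  \sum_x mu x * Y x `^ r <= (\sum_x mu x * Y x `^ (r - 1)) `^ (r / (r - 1))
    + r / 2 / alpha * \sum_x mu x * (Y x `^ (r - 2) * neg_gradient f x).
Proof.
move=> r2 YE.
have r1 : 0 < r - 1 by lra.
have q12 : 1 < r / (r - 1) <= 2.
  by rewrite ltr_pdivlMr// ler_pdivrMr//; apply/andP; split; lra.
have Y0 x : 0 <= Y x by rewrite YE le_max lexx orbT.
have := beckner_ineq q12 (fun x => powR_ge0 (Y x) (r - 1)).
have q1E : r / (r - 1) - 1 = (r - 1)^-1 by field; rewrite gt_eqF.
have -> : zr_dirichlet p lambda (fun x => Y x `^ (r - 1))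
    (fun x => (Y x `^ (r - 1)) `^ (r / (r - 1) - 1))
  = zr_dirichlet p lambda (fun x => Y x `^ (r - 1)) Y.
  congr zr_dirichlet; apply/funext => x.
  by rewrite q1E -powRrM mulfV ?gt_eqF// powRr1.
have -> : mean (fun x => (Y x `^ (r - 1)) `^ (r / (r - 1))) = \sum_x mu x * Y x `^ r.
  by apply: eq_bigr => x _; rewrite -powRrM mulrCA mulfV ?gt_eqF// mulr1.
rewrite -/(mean _) => H.
have := @zr_dirichlet_le (fun x => Y x `^ (r - 1)) Y (fun x => (r - 1) * Y x `^ (r - 2)) f.
have r2E : r - 1 - 1 = r - 2 by ring.
have -> : mean (fun x => (r - 1) * Y x `^ (r - 2) * neg_gradient f x)
    = (r - 1) * \sum_x mu x * (Y x `^ (r - 2) * neg_gradient f x).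
  by rewrite mulr_sumr; apply: eq_bigr => x _; ring.
move=> H1; have {}H1 := H1 _.
have {}H1 : zr_dirichlet p lambda (fun x => Y x `^ (r - 1)) Y
    <= (r - 1) * \sum_x mu x * (Y x `^ (r - 2) * neg_gradient f x).
  apply: H1 => x y; rewrite !YE mulrC -r2E.
  have := @pospart_increment R (f x - mean f) (f y - mean f) (r - 1).
  have e a b : a - mean f - (b - mean f) = a - b by ring.
  by rewrite !e; apply; lra.
have q0 : 0 <= r / (r - 1) / 2 by case/andP: q12 => q1 _; lra.
have := le_trans H (ler_wpM2l q0 H1).
set S := \sum_x mu x * (_ * neg_gradient f x).
have -> : r / (r - 1) / 2 * ((r - 1) * S) = alpha * (r / 2 / alpha * S).
  by field; rewrite !gt_eqF.
rewrite ler_pM2l// lerBlDl; exact.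
Qed.

(** Beckner's inequality at q = 2 is a Poincaré inequality, which starts the iteration over moments.
    Adding c makes f nonnegative and changes neither side. *)
Lemma variance_le f :
  \sum_x mu x * (f x - mean f) ^+ 2 <= alpha^-1 * mean (neg_gradient f).
Proof.
pose c := \sum_(x : config n m) `|f x|.
have h0 x : 0 <= f x + c.
  rewrite /c (bigD1 x)//= addrA addr_ge0 ?sumr_ge0// addrC.
  by have := ler_norm (- f x); rewrite normrN; lra.
have meanh : mean (fun x => f x + c) = mean f + c.
  rewrite /zr_mean; under eq_bigr do rewrite mulrDr.
  by rewrite big_split/= -mulr_suml mu1 mul1r.
have q2 : 1 < (2 : R) <= 2 by rewrite lexx andbT ltr1n.
have := beckner_ineq q2 h0; rewrite meanh.
have sq (a : R) : 0 <= a -> a `^ 2 = a ^+ 2 by exact: powR_mulrn.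
have mean0 : 0 <= mean f + c.
  by rewrite -meanh; apply: sumr_ge0 => x _; rewrite mulr_ge0.
rewrite sq//.
have -> : mean (fun x => (f x + c) `^ 2) - (mean f + c) ^+ 2
    = \sum_x mu x * (f x - mean f) ^+ 2.
  have -> : \sum_x mu x * (f x - mean f) ^+ 2 = mean (fun x => (f x + c) `^ 2)
    - 2 * (mean f + c) * mean (fun x => f x + c)
    + (mean f + c) ^+ 2 * \sum_(x : config n m) mu x.
    rewrite /zr_mean !mulr_sumr -sumrB -big_split/=; apply: eq_bigr => x _.
    by rewrite sq//; ring.
  by rewrite meanh mu1; ring.
rewrite mulfV ?pnatr_eq0// mul1r => H.
rewrite ler_pdivlMl//; apply: le_trans H _.
have -> : mean (neg_gradient f) = mean (fun x => 1 * neg_gradient f x).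
  by apply: eq_bigr => x _; rewrite mul1r.
apply: zr_dirichlet_le => x y; rewrite !mul1r.
have -> : (2 : R) - 1 = 1 by ring.
rewrite !powRr1// -!/(_ ^+ 2).
have -> : f y + c - (f x + c) = f y - f x by ring.
rewrite !opprB; case: (leP (f x) (f y)) => xy.
- have -> : Num.max (f x - f y) 0 = 0 by apply/max_idPr; rewrite subr_le0.
  have -> : Num.max (f y - f x) 0 = f y - f x by apply/max_idPl; rewrite subr_ge0.
  by rewrite expr0n/= add0r -expr2.
- have -> : Num.max (f y - f x) 0 = 0 by apply/max_idPr; rewrite subr_le0 ltW.
  have -> : Num.max (f x - f y) 0 = f x - f y by apply/max_idPl; rewrite subr_ge0 ltW.
  by rewrite expr0n/= addr0 -(sqrrN (f x - f y)) opprB expr2.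
Qed.

(* The constant sqrt e / (2 (sqrt e - 1)) comes from (1 - 1/s)^(s/2) <= e^(-1/2). *)
Lemma moment_bound f (Y : config n m -> R) r : 2 <= r ->
  (forall x, Y x = Num.max (f x - mean f) 0) ->
  (\sum_x mu x * Y x `^ r) `^ (2 / r)
  <= (2 * (1 - expR (- 2^-1)))^-1 * r / alpha
     * (\sum_x mu x * neg_gradient f x `^ (r / 2)) `^ (2 / r).
Proof.
move=> r2 YE.
set w := expR (- 2^-1); set kappa := (2 * _)^-1; set V := neg_gradient f.
have V0 x : 0 <= V x by apply: neg_gradient_ge0.
have Y0 x : 0 <= Y x by rewrite YE le_max lexx orbT.
have w_half : 2^-1 <= w.
  by apply: le_trans (expR_ge1Dx _); lra.
have w1 : w < 1 by rewrite expR_lt1 oppr_lt0.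
have kappa1 : 1 <= kappa by rewrite /kappa invr_ge1 ?unitfE; lra.
pose N s := (\sum_x mu x * Y x `^ s) `^ (2 / s).
pose B s := (\sum_x mu x * V x `^ (s / 2)) `^ (2 / s) / alpha.
have B0 s : 0 <= B s by rewrite divr_ge0 ?powR_ge0// ltW.
have B_le s t : 0 < s -> s <= t -> B s <= B t.
  move=> s0 st; apply: ler_wpM2r; first by rewrite invr_ge0 ltW.
  have := @moment_le R _ mu mu0 mu1 V (s / 2) (t / 2).
  rewrite !invf_div; apply => //; last by rewrite ler_pM2r.
  exact: divr_gt0.
have N_le s t : 0 < s -> s <= t -> N s <= N t.
  move=> s0 st; rewrite /N.
  have t0 : 0 < t by exact: lt_le_trans st.
  have powE (z e : R) : z `^ (2 / e) = (z `^ e^-1) `^ 2 by rewrite -powRrM mulrC.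
  rewrite !powE; apply: ge0_ler_powR; first exact: ler0n.
  - by rewrite nnegrE; exact: powR_ge0.
  - by rewrite nnegrE; exact: powR_ge0.
  - exact: (moment_le mu0 mu1 s0 st Y0).
have N2 : N 2 <= B 2.
  rewrite /N /B mulfV ?pnatr_eq0// !powRr1; first last.
  - by apply: sumr_ge0 => x _; rewrite mulr_ge0 ?powR_ge0.
  - by apply: sumr_ge0 => x _; rewrite mulr_ge0 ?powR_ge0.
  have := variance_le f.
  rewrite mulrC; under [X in _ -> _ <= X / _]eq_bigr do rewrite powRr1//.
  apply: le_trans; apply: ler_sum => x _; apply: ler_wpM2l => //.
  rewrite powR_mulrn// YE; case: (leP (f x - mean f) 0) => _ //.
  by rewrite expr0n/= sqr_ge0.
(* The recursion lowers the real exponent s by 1, so the induction runs over intervals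
   [2, 2 + k]. *)
suff H k : forall s, 2 <= s -> s <= 2 + k%:R -> N s <= kappa * s * B s.
  have [k rk] : exists k : nat, r <= 2 + k%:R.
    exists (Num.truncn r).+1; have := truncnS_gt r; lra.
  by have := H k r r2 rk; rewrite /N /B !mulrA [X in _ -> _ <= X]mulrAC.
elim: k => [|k IH] s s2 sk.
  have -> : s = 2 by apply/le_anti; rewrite s2 andbT; move: sk; rewrite addr0.
  apply: le_trans N2 _; rewrite ler_peMl//.
  by apply: (@le_trans _ _ (1 * 2)); [lra|rewrite ler_pM2r].
have s0 : 0 < s by lra.
have s1 : 0 < s - 1 by lra.
have z_le : N (s - 1) <= kappa * (s - 1) * B s.
  (* For s <= 3 the exponent s - 1 lies below the range of the induction hypothesis; monotonicity of
     norms and the variance bound suffice there, since kappa (s - 1) >= 1. *)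
  have [s3|/ltW s3] := leP s 3.
    apply: (@le_trans _ _ (N 2)); first by apply: N_le; lra.
    apply: le_trans N2 _; apply: le_trans (B_le 2 s _ s2) _ => //.
    rewrite ler_peMl//; apply: (@le_trans _ _ (1 * 1)); first by rewrite mulr1.
    by apply: ler_pM => //; lra.
  apply: (@le_trans _ _ (kappa * (s - 1) * B (s - 1))).
    by apply: IH; [lra|move: sk; rewrite -natr1; lra].
  by apply: ler_wpM2l; [apply: mulr_ge0; lra|apply: B_le; lra].
have Ns0 : 0 <= N s by exact: powR_ge0.
refine (@moment_self_bound R (N (s - 1)) _ _ _ s2 Ns0 (powR_ge0 _ _) (B0 s) z_le _).
pose M s := \sum_x mu x * Y x `^ s.
have M0 t : 0 <= M t by apply: sumr_ge0 => x _; rewrite mulr_ge0// powR_ge0.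
have MN t : 0 < t -> M t = N t `^ (t / 2).
  move=> t0; rewrite /N -powRrM -[LHS]powRr1//; congr (_ `^ _); field.
  by rewrite gt_eqF.
have rec := moment_recursion s2 YE.
rewrite -/(M s) -/(M (s - 1)) in rec.
have holder : (\sum_x mu x * (Y x `^ (s - 2) * V x)) / alpha <= N s `^ (s / 2 - 1) * B s.
  rewrite /B mulrA ler_pM2r ?invr_gt0//.
  (* At s = 2 the Hölder exponent degenerates, but Y^0 = 1 and the claim is immediate. *)
  have [s2'|s2'] := eqVneq s 2.
    rewrite s2' subrr mulfV ?pnatr_eq0// subrr powRr0 mul1r powRr1; last first.
      by apply: sumr_ge0 => x _; rewrite mulr_ge0 ?powR_ge0.
    by apply: ler_sum => x _; rewrite powRr0 powRr1// mul1r.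
  have t01 : 0 < 2 / s < 1.
    rewrite divr_gt0//= ltr_pdivrMr// mul1r.
    by rewrite lt_def s2'.
  have := @finite_hoelder R _ mu mu0 (fun x => Y x `^ s) (fun x => V x `^ (s / 2)) (2 / s)
    t01 (fun x => powR_ge0 _ _) (fun x => powR_ge0 _ _).
  have ME : M s `^ (1 - 2 / s) = N s `^ (s / 2 - 1).
    by rewrite (MN s s0) -(powRrM (N s)); congr (_ `^ _); field; rewrite gt_eqF.
  rewrite -/(M s) ME; apply: le_trans; apply: ler_sum => x _; apply: ler_wpM2l => //.
  rewrite -!powRrM.
  have -> : s * (1 - 2 / s) = s - 2 by field; rewrite gt_eqF.
  have -> : s / 2 * (2 / s) = 1 by field; rewrite gt_eqF.
  by rewrite powRr1.
have E1 : M (s - 1) `^ (s / (s - 1)) = N (s - 1) `^ (s / 2).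
  rewrite (MN _ s1) -(powRrM (N (s - 1))); congr (_ `^ _).
  by field; rewrite gt_eqF.
have E2 := MN s s0.
have c0 : 0 <= s / 2 by rewrite divr_ge0// ltW.
have := ler_wpM2l c0 holder; have := alpha_gt0.
move: rec; set S := \sum_x mu x * (_ * _).
rewrite E1 E2; clear -alpha.
clearbody N B S; move: (N s `^ (s / 2 - 1)) => Q H0 a0 H1.
apply: le_trans H0 _; rewrite lerD2l; apply: le_trans H1.
by rewrite le_eqVlt; apply/orP; left; apply/eqP; field; rewrite gt_eqF.
Qed.

End Moments.

(** * Integrals of functions of a random element of a finite set *)

Section DiscreteLaw.
Context d (T : measurableType d) (R : realType) (P : probability T R).
Variables (S : finType) (X : T -> S) (w : S -> R).
Hypothesis X_law : has_law P X w.

(** [has_law] only gives measurable preimages of points, so g(X) is written as a finite sum of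
    indicators. *)
Lemma ge0_integral_law (g : S -> R) : (forall x, 0 <= g x) ->
  (\int[P]_t (g (X t))%:E = (\sum_x w x * g x)%:E)%E.
Proof.
move=> g0.
have mX x : measurable (X @^-1` [set x])%classic by case: (X_law x).
have XE t : (g (X t))%:E = (\sum_x (g x)%:E * (\1_(X @^-1` [set x])%classic t)%:E)%E.
  rewrite (bigD1 (X t))//= big1 ?adde0 => [|x xX].
    by rewrite indicE mem_set// mule1.
  by rewrite indicE memNset ?mule0// => /= E; rewrite E eqxx in xX.
under eq_integral do rewrite XE.
rewrite ge0_integral_sum//; last 2 first.
- move=> x; apply: emeasurable_funM; first exact: measurable_cst.
  by apply/measurable_EFinP; exact: measurable_indic.
- by move=> x t _; rewrite mule_ge0// lee_fin.
rewrite -sumEFin; apply: eq_bigr => x _.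
rewrite ge0_integralZl_EFin//; last by apply/measurable_EFinP; exact: measurable_indic.
have Px : (P : {measure set T -> \bar R}) (X @^-1` [set x])%classic = (w x)%:E := (X_law x).2.
by rewrite integral_indic// classical_sets.setIT Px -EFinM mulrC.
Qed.

Lemma expectation_law (g : S -> R) : ('E_P[g \o X] = (\sum_x w x * g x)%:E)%E.
Proof.
rewrite unlock integralE.
under eq_integral do rewrite funeposE/= -EFin_max.
under [X in (_ - X)%E]eq_integral do rewrite funenegE/= -EFin_max.
rewrite (ge0_integral_law (g := fun x => Num.max (g x) 0)); last first.
  by move=> x; rewrite le_max lexx orbT.
rewrite (ge0_integral_law (g := fun x => Num.max (- g x) 0)); last first.
  by move=> x; rewrite le_max lexx orbT.
rewrite -EFinB -sumrB; congr (_%:E); apply: eq_bigr => x _; rewrite -mulrBr.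
congr (_ * _); case: (leP (g x) 0) => gx.
  by rewrite sub0r max_l ?oppr_ge0// opprK.
by rewrite max_r ?subr0// oppr_le0 ltW.
Qed.

Lemma Lnorm_law (g : S -> R) (r : R) : (forall x, 0 <= g x) ->
  ('N[P]_(r%:E)[(fun t => (g (X t))%:E)] = ((\sum_x w x * g x `^ r) `^ r^-1)%:E)%E.
Proof.
move=> g0; rewrite unlock -poweR_EFin; congr (_ `^ _)%E.
rewrite -(ge0_integral_law (g := fun x => g x `^ r)); last by move=> x; exact: powR_ge0.
by apply: eq_integral => t _; rewrite /= ger0_norm// poweR_EFin.
Qed.

End DiscreteLaw.

Theorem corollary4p15 (R : realType) (m n : nat) (p : 'I_n -> R)
    (lambda : 'I_n -> nat -> R) (delta Delta : R)
    (m_gt0 : (0 < m)%N) (n_gt0 : (0 < n)%N)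
    (p_ge0 : forall i, 0 <= p i) (p_sum1 : \sum_(i < n) p i = 1)
    (delta_gt0 : 0 < delta) (Delta_gt0 : 0 < Delta)
    (lambda_ge0 : forall i l, (l <= m)%N -> 0 <= lambda i l)
    (lambda0 : forall i, lambda i 0%N = 0)
    (lambda_incr : forall i l, (l < m)%N ->
       delta <= lambda i l.+1 - lambda i l <= Delta) :
  [/\ (forall x : config n m, 0 <= zr_mu p lambda x) /\
      \sum_(x : config n m) zr_mu p lambda x = 1,
      @zr_reversible R n m p lambda,
      forall q : R, 1 < q <= 2 ->
        exists alpha : R, delta ^+ 2 / (12 * Delta) <= alpha /\
          forall f : config n m -> R, (forall x, 0 <= f x) ->
            alpha * (zr_mean p lambda (fun x => f x `^ q)
                     - (zr_mean p lambda f) `^ q)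
              <= q / 2 * zr_dirichlet p lambda f (fun x => f x `^ (q - 1))
    & forall (d : measure_display) (T : measurableType d) (P : probability T R)
        (X : T -> config n m), has_law P X (zr_mu p lambda) ->
      forall (f : config n m -> R) (r : R), 2 <= r ->
        let K := Num.sqrt (6 * Num.sqrt (expR 1) / (Num.sqrt (expR 1) - 1)) in
        ('N[P]_(r%:E)[(fun t =>
             (Num.max (f (X t) - fine 'E_P[f \o X]) 0)%:E)]
         <= (K * (Num.sqrt Delta / delta) * Num.sqrt r)%:E
            * 'N[P]_(r%:E)[(fun t =>
                (Num.sqrt (\sum_(i < n) \sum_(j < n)
                   Num.max (- (f (move (X t) i j) - f (X t))) 0 ^+ 2
                   * lambda i (occ (X t) i) * p j))%:E)])%E].
Proof.
have lambda_pos := lambda_gt0 delta_gt0 lambda0 lambda_incr.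
have alpha_gt0 : 0 < delta ^+ 2 / (12 * Delta).
  by rewrite divr_gt0 ?exprn_gt0// mulr_gt0.
have beckner_ineq f q := @beckner R n m p lambda delta Delta p_ge0 p_sum1 delta_gt0
  Delta_gt0 lambda0 lambda_incr f q.
split.
- by split; [move=> x; exact: zr_mu_ge0|exact: zr_mu_sum1].
- exact: zr_reversibleP.
- move=> q q12; exists (delta ^+ 2 / (12 * Delta)); split=> // f f0.
  exact: beckner_ineq.
move=> d T P X X_law f r r2; lazy zeta; set K := Num.sqrt (6 * _ / _).
have r0 : 0 < r by exact: lt_le_trans r2.
rewrite (expectation_law X_law)/= -/(zr_mean p lambda f).
pose Y x := Num.max (f x - zr_mean p lambda f) 0.
pose V := neg_gradient p lambda f.
have V0 x : 0 <= V x by exact: (neg_gradient_ge0 p_ge0 lambda0 lambda_pos).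
rewrite (Lnorm_law X_law (g := Y)); last by move=> x; rewrite /Y le_max lexx orbT.
rewrite (Lnorm_law X_law (g := fun x => Num.sqrt (V x))); last by move=> x; exact: sqrtr_ge0.
rewrite -EFinM lee_fin.
have := moment_bound p_ge0 p_sum1 lambda0 lambda_pos alpha_gt0 beckner_ineq
  (f := f) (Y := Y) r2 (fun x => erefl).
rewrite -/V.
have -> : \sum_x zr_mu p lambda x * Num.sqrt (V x) `^ r
    = \sum_x zr_mu p lambda x * V x `^ (r / 2).
  by apply: eq_bigr => x _; rewrite -powR12_sqrt// -powRrM (mulrC 2^-1).
set A := \sum_x _; set B := \sum_x _ => H.
have half (z : R) : 0 <= z -> z `^ r^-1 = Num.sqrt (z `^ (2 / r)).
  move=> z0; rewrite -powR12_sqrt ?powR_ge0// -powRrM; congr (_ `^ _); field.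
  by rewrite gt_eqF.
have mu0 x : 0 <= zr_mu p lambda x := zr_mu_ge0 lambda_pos p_ge0 p_sum1 x.
rewrite !half; first last.
- by apply: sumr_ge0 => x _; rewrite mulr_ge0 ?powR_ge0.
- by apply: sumr_ge0 => x _; rewrite mulr_ge0 ?powR_ge0.
apply: le_trans (ler_wsqrtr H) _.
have eE : Num.sqrt (expR 1) = expR 2^-1 :> R.
  by rewrite -powR12_sqrt ?expR_ge0// -expRM mul1r.
have e1 : 1 < expR 2^-1 :> R by rewrite expR_gt1.
have e0 : 0 < expR 2^-1 - 1 :> R by rewrite subr_gt0.
(* Dividing kappa by delta^2 / (12 Delta) gives the factor 12 / 2 = 6, and 1 / (1 - e^(-1/2)) = sqrt
   e / (sqrt e - 1): this is K^2 Delta / delta^2 times r. *)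
have -> : (2 * (1 - expR (- 2^-1)))^-1 * r / (delta ^+ 2 / (12 * Delta))
  = 6 * Num.sqrt (expR 1) / (Num.sqrt (expR 1) - 1) * (Delta / delta ^+ 2) * r.
  rewrite eE expRN; field.
  by rewrite !gt_eqF ?expR_gt0// invr_lt1 ?unitf_gt0 ?expR_gt0.
have k0 : 0 <= 6 * Num.sqrt (expR 1) / (Num.sqrt (expR 1) - 1) :> R.
  by rewrite eE divr_ge0 ?mulr_ge0 ?expR_ge0// ltW.
have d0 : 0 <= Delta / delta ^+ 2 by rewrite divr_ge0 ?sqr_ge0// ltW.
rewrite sqrtrM; last by apply: mulr_ge0; [exact: mulr_ge0|exact: ltW].
rewrite sqrtrM; last exact: mulr_ge0.
rewrite sqrtrM// -/K sqrtrM ?(ltW Delta_gt0)// sqrtrV ?sqr_ge0//.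
by rewrite sqrtr_sqr gtr0_norm.
Qed.
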